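(* Let $1<p\leq 2$. There exists a constant $C_p>0$ such that for all $N\in\mathbb{N}$ and every $f:\mathbb{Z}\to\mathbb{R}$, $$\|\mathcal A_Nf\|_{p'}\leq C_p\,N^{\frac{1}{p'}-\frac{1}{p}}\|f\|_p,$$ where $\mathcal A_{N}f(x)=\frac{1}{N}\sum_{q\leq N,\ q \text{ prime}}f(x-q)\log q$ for $x\in\mathbb{Z}$.
   Context: For $f:\mathbb{Z}\to\mathbb{R}$, $\|f\|_p$ denotes the $\ell^p(\mathbb{Z})$-norm, and $p'=\frac{p}{p-1}$ is the conjugate exponent. $\log$ is the natural logarithm. *)

(* Defs.v *)
From mathcomp Require Import all_boot all_order all_algebra.
From mathcomp Require Import all_classical all_reals all_analysis.
Set Implicit Arguments. Unset Strict Implicit. Unset Printing Implicit Defensive.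
Import Order.TTheory GRing.Theory Num.Theory.
Local Open Scope classical_set_scope.
Local Open Scope ring_scope.

(* ell^p(Z) norm of f : int -> R, valued in the extended reals
   (+oo when f is not p-summable):  (sum_{x in Z} |f x|^p)^(1/p). *)
Definition lpnorm (R : realType) (p : R) (f : int -> R) : \bar R :=
  poweR (esum [set: int] (fun x => (`|f x| `^ p)%:E)) p^-1.

Definition conj_exp (R : realType) (p : R) : R := p / (p - 1).

Definition avgA (R : realType) (N : nat) (f : int -> R) (x : int) : R :=
  N%:R^-1 * \sum_(q < N.+1 | prime q) f (x - (q : nat)%:Z) * ln (q : nat)%:R.

(* Main.v *)
Require Import Defs.
From mathcomp Require Import all_boot all_order all_algebra.
From mathcomp Require Import all_classical all_reals all_analysis.
From mathcomp Require Import ring lra zify.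
Set Implicit Arguments. Unset Strict Implicit. Unset Printing Implicit Defensive.
Import Order.TTheory GRing.Theory Num.Theory.
Local Open Scope classical_set_scope.
Local Open Scope ring_scope.

(** The circle method is not needed. Cut the integers into blocks of length [N] and fix
    an integer [k > p']. On a block, bound the [l^p'] norm of the average by its [l^k]
    norm and expand the [k]-th power: this gives the sum over [y] in [[0, 2N)^k] of
    [prod_i f(y_i)] against [W(y)], the weighted count of the [t] for which all the
    numbers [N + t - y_i] are prime. An upper bound sieve yields
    [W(y) <= C N prod_(i <> j) h(y_i - y_j)^k] with [h(n) = prod_(p | n) p / (p - 1)]
    when the [y_i] are distinct, with no logarithmic loss, and [W(y) <= N (log N)^k]
    always. As all moments of [h] are bounded on average, Hölder's inequality in [y] with
    exponents [p] and [p'] gives the local estimate, and [p <= p'] lets one sum the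
    blocks.

    The sieve is Selberg's, in dual form: if [t] avoids [k] classes modulo every sifting
    prime then the function [F(t) = sum_(d <= Q) prod_(p | d) (- phi_p(t))] takes the
    value [L = sum_(d <= Q) prod_(p | d) k / (p - k)], while the
    orthogonality of the products of the [phi_p] gives [sum_t F(t)^2 <= N L + O(Q^6)]. The lower bound [L >= (sum_(n <= Y) 1 / n)^k], with
    [Q = Y^k] and [n] composed of sifting primes, needs no information on the
    distribution of primes. *)

(** * Sums over squarefree divisors and the quadratic form of the sieve *)

Lemma eq_ler (R : numDomainType) (x y : R) : x = y -> x <= y.
Proof. by move->. Qed.

(* The sum of [prod_(p in S) a p] over the sublists [S] of [P] whose product is at most [Q];
   iterated floors of quotients compose, so the level can be divided one prime at a time. *)
Fixpoint tprod (R : realFieldType) (P : seq nat) (a : nat -> R) (Q : nat) : R :=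
  if P is p :: P' then tprod P' a Q + a p * tprod P' a (Q %/ p)
  else (0 < Q)%:R.

Lemma tprod_ge0 (R : realFieldType) (P : seq nat) (a : nat -> R) (Q : nat) :
  {in P, forall p, 0 <= a p} -> 0 <= tprod P a Q.
Proof.
elim: P Q => [|p P IH] Q a_ge0 /=; first exact: ler0n.
have aP : {in P, forall q, 0 <= a q} by move=> q qP; apply: a_ge0; rewrite inE qP orbT.
by rewrite addr_ge0 ?mulr_ge0 ?IH // a_ge0 // mem_head.
Qed.

Lemma tprod_le_level (R : realFieldType) (P : seq nat) (a : nat -> R) (Q Q' : nat) :
  {in P, forall p, 0 <= a p} -> (Q <= Q')%N -> tprod P a Q <= tprod P a Q'.
Proof.
elim: P Q Q' => [|p P IH] Q Q' a_ge0 leQ /=.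
  by rewrite ler_nat; case: Q leQ => //= Q; case: Q'.
have aP : {in P, forall q, 0 <= a q} by move=> q qP; apply: a_ge0; rewrite inE qP orbT.
rewrite lerD ?IH // ler_wpM2l ?IH ?leq_div2r //.
by apply: a_ge0; rewrite mem_head.
Qed.

Lemma le_tprod (R : realFieldType) (P : seq nat) (a b : nat -> R) (Q : nat) :
  {in P, forall p, 0 <= a p <= b p} -> tprod P a Q <= tprod P b Q.
Proof.
elim: P Q => [|p P IH] Q ab //=.
have abP : {in P, forall q, 0 <= a q <= b q} by move=> q qP; apply: ab; rewrite inE qP orbT.
have /andP[a0 leab] := ab p (mem_head _ _).
rewrite lerD ?IH // ler_pM ?IH //.
by apply: tprod_ge0 => q /abP /andP[].
Qed.

Lemma eq_in_tprod (R : realFieldType) (P : seq nat) (a b : nat -> R) (Q : nat) :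
  {in P, a =1 b} -> tprod P a Q = tprod P b Q.
Proof.
elim: P Q => [|p P IH] Q ab //=.
have abP : {in P, a =1 b} by move=> q qP; apply: ab; rewrite inE qP orbT.
by rewrite !IH // ab // mem_head.
Qed.

Lemma tprod_ge1 (R : realFieldType) (P : seq nat) (a : nat -> R) (Q : nat) :
  {in P, forall p, 0 <= a p} -> (0 < Q)%N -> 1 <= tprod P a Q.
Proof.
elim: P => [|p P IH] a_ge0 Q0 /=; first by rewrite Q0.
have aP : {in P, forall q, 0 <= a q} by move=> q qP; apply: a_ge0; rewrite inE qP orbT.
by rewrite ler_wpDr ?IH // mulr_ge0 ?tprod_ge0 ?a_ge0 ?mem_head.
Qed.

(** Group the pairs of sublists by their union: a prime of the union lies in the first only, in the
    second only or in both, whence [a + b + a b], and the union has product at most [Q Q']. *)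
Lemma tprodM_le (R : realFieldType) (P : seq nat) (a b c : nat -> R) (Q Q' : nat) :
  {in P, forall p, [/\ 0 <= a p, 0 <= b p & a p + b p + a p * b p <= c p]} ->
  tprod P a Q * tprod P b Q' <= tprod P c (Q * Q').
Proof.
elim: P Q Q' => [|p P IH] Q Q' abc /=.
  by rewrite -natrM ler_nat; case: Q; case: Q'.
have abcP : {in P, forall p, [/\ 0 <= a p, 0 <= b p & a p + b p + a p * b p <= c p]}.
  by move=> q qP; apply: abc; rewrite inE qP orbT.
have [a0 b0 abcp] := abc p (mem_head _ _).
have cP : {in P, forall p, 0 <= c p}.
  by move=> q /abcP[aq bq]; apply: le_trans; rewrite !addr_ge0 ?mulr_ge0.
have IHc n n' m : (n * n' <= m)%N -> tprod P a n * tprod P b n' <= tprod P c m.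
  by move=> le_m; apply: le_trans (IH _ _ abcP) (tprod_le_level cP le_m).
have c0 : 0 <= tprod P c (Q * Q' %/ p) by exact: tprod_ge0.
apply: le_trans (_ : tprod P c (Q * Q') + (a p + b p + a p * b p) *
   tprod P c (Q * Q' %/ p) <= _); last by rewrite lerD2l ler_wpM2r.
have e1 := IHc Q Q' _ (leqnn _).
(* At [p = 0] the quotients are [0] by convention, and [tprod] vanishes at level [0]. *)
have [p0|p_gt0] := posnP p.
  have z : forall d : nat -> R, tprod P d 0 = 0.
    by move=> d; elim: {abc IH abcP cP IHc c0 e1} P => //= q s IHs; rewrite div0n IHs mulr0 addr0.
  by rewrite p0 !divn0 !z !mulr0 !addr0.
have e2 : tprod P a (Q %/ p) * tprod P b Q' <= tprod P c (Q * Q' %/ p).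
  by apply: IHc; rewrite leq_divRL // mulnAC leq_mul2r leq_divM orbT.
have e3 : tprod P a Q * tprod P b (Q' %/ p) <= tprod P c (Q * Q' %/ p).
  by apply: IHc; rewrite leq_divRL // -mulnA leq_mul2l leq_divM orbT.
have e4 : tprod P a (Q %/ p) * tprod P b (Q' %/ p) <= tprod P c (Q * Q' %/ p).
  apply: IHc; rewrite leq_divRL // -mulnA leq_mul ?leq_divM //.
  by rewrite leq_div.
have e2' := ler_wpM2l a0 e2.
have e3' := ler_wpM2l b0 e3.
have e4' := ler_wpM2l (mulr_ge0 a0 b0) e4.
lra.
Qed.

Lemma periodic_modn (T : Type) (m : nat) (u : nat -> T) (t : nat) :
  (forall t, u (t + m)%N = u t) -> u (t %% m)%N = u t.
Proof.
move=> um; rewrite {2}(divn_eq t m) addnC.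
by elim: (t %/ m)%N => [|j ->] //=; rewrite ?mul0n ?addn0 // mulSn [(m + _)%N]addnC addnA um.
Qed.

Lemma periodic_addM (T : Type) (m : nat) (u : nat -> T) (t j : nat) :
  (forall t, u (t + m)%N = u t) -> u (t + m * j)%N = u t.
Proof. by move=> um; elim: j => [|j <-]; rewrite ?muln0 ?addn0 // mulnSr addnA um. Qed.

Lemma big_nat_blocks (R : nmodType) (F : nat -> R) (m n : nat) :
  \sum_(0 <= t < m * n) F t = \sum_(0 <= j < n) \sum_(0 <= i < m) F (i + m * j)%N.
Proof.
elim: n => [|n IH]; first by rewrite muln0 !big_geq.
rewrite big_nat_recr //= -IH mulnS addnC (big_cat_nat (n := (m * n)%N)) ?leq_addr //=.
by congr (_ + _); rewrite -{1}[(m * n)%N]add0n big_addn addKn.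
Qed.

(** Chinese remainder theorem: for a fixed class [i] modulo [m], the numbers [i + m j] run through
    all classes modulo [n] as [j] does. *)
Lemma sum_coprime_periodic (R : realFieldType) (m n : nat) (u v : nat -> R) :
  (0 < n)%N -> coprime m n ->
  (forall t, u (t + m)%N = u t) -> (forall t, v (t + n)%N = v t) ->
  \sum_(0 <= t < m * n) u t * v t =
  (\sum_(0 <= t < m) u t) * (\sum_(0 <= t < n) v t).
Proof.
move=> n0 cop um vn; rewrite big_nat_blocks exchange_big /= mulr_suml.
apply: eq_bigr => i _.
have uE j : u (i + m * j)%N = u i.
  exact: periodic_addM.
under eq_bigr do rewrite uE.
rewrite -mulr_sumr; congr (_ * _); rewrite !big_mkord.
pose h (j : 'I_n) : 'I_n := Ordinal (ltn_pmod (i + m * j) n0).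
rewrite [RHS](reindex_inj (h := h)) /=.
  by apply: eq_bigr => j _; rewrite (periodic_modn _ vn).
move=> j j' /(congr1 val) /= /eqP; rewrite eqn_modDl => eqj.
apply/val_inj => /=.
wlog lejj : j j' eqj / (j' <= j)%N.
  move=> W; case: (leqP j' j) => [|/ltnW] le; first exact: W.
  by apply/esym/W => //; rewrite eq_sym.
move: eqj; rewrite eqn_mod_dvd ?leq_mul2l ?lejj ?orbT // -mulnBr Gauss_dvdr 1?coprime_sym //.
move=> dvd; apply/eqP; rewrite eqn_leq lejj andbT -subn_eq0.
rewrite -leqn0 leqNgt; apply/negP => /dvdn_leq/(_ dvd).
by rewrite leqNgt (leq_ltn_trans (leq_subr _ _)).
Qed.

(** The incomplete last period and the rounding of [N / m] to an integer each cost at most [m B]. *)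
Lemma sum_periodic_le (R : realFieldType) (m N : nat) (u : nat -> R) (B : R) :
  (0 < m)%N -> (forall t, u (t + m)%N = u t) -> (forall t, `|u t| <= B) ->
  \sum_(0 <= t < N) u t <=
  N%:R / m%:R * (\sum_(0 <= t < m) u t) + 2 * m%:R * B.
Proof.
move=> m0 um uB.
set U := \sum_(0 <= t < m) u t.
have mR : 0 < m%:R :> R by rewrite ltr0n.
have B0 : 0 <= B by apply: le_trans (uB 0%N).
have bnd r : (r <= m)%N -> `|\sum_(0 <= t < r) u t| <= r%:R * B.
  move=> _; apply: le_trans (ler_norm_sum _ _ _) _.
  apply: le_trans (ler_sum _ (fun i _ => uB i)) _.
  by rewrite sumr_const_nat subn0 mulr_natl.
have e1 : \sum_(0 <= t < N) u t = (N %/ m)%N%:R * U + \sum_(0 <= t < (N %% m)%N) u t.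
  rewrite {1}(divn_eq N m) (big_cat_nat (n := (N %/ m * m)%N)) ?leq_addr //=.
  congr (_ + _).
    rewrite mulnC big_nat_blocks mulr_natl -[in RHS](subn0 (N %/ m)%N) -sumr_const_nat.
    apply: eq_bigr => j _; apply: eq_bigr => i _.
    exact: periodic_addM.
  rewrite -{1}[(_ * m)%N]add0n big_addn addKn; apply: eq_bigr => i _.
  by rewrite mulnC periodic_addM.
have lt_r : (N %% m <= m)%N by apply/ltnW/ltn_pmod.
have b1 := bnd _ lt_r; have b2 := bnd _ (leqnn m); rewrite -/U in b2.
have NE : N%:R = (N %/ m)%N%:R * m%:R + (N %% m)%N%:R :> R.
  by rewrite -natrM -natrD -divn_eq.
have b1' : \sum_(0 <= t < (N %% m)%N) u t <= m%:R * B.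
  apply: le_trans (ler_norm _) (le_trans b1 _).
  by rewrite ler_wpM2r // ler_nat.
have b2' : - (m%:R * B) <= (N %% m)%N%:R / m%:R * U.
  have c0 : 0 <= (N %% m)%N%:R / m%:R :> R by rewrite divr_ge0 ?ler0n.
  have c1 : (N %% m)%N%:R / m%:R <= 1 :> R by rewrite ler_pdivrMr // mul1r ler_nat.
  have U1 : - (m%:R * B) <= U by move: b2; rewrite ler_norml => /andP[].
  have mB : 0 <= m%:R * B by rewrite mulr_ge0 ?ler0n.
  apply: le_trans (ler_wpM2l c0 U1).
  by rewrite mulrN lerN2 ler_piMl.
rewrite e1 NE mulrDl mulfK ?gt_eqF // mulrDl -addrA lerD2l.
lra.
Qed.

(* Chosen to have mean zero modulo [p], hence mean square [k / (p - k)], when [bad p] consists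
   of [k] classes. *)
Definition sieve_phi (R : realFieldType) (k : nat) (bad : nat -> nat -> bool) (p t : nat) : R :=
  if bad p t then 1 else - (k%:R / (p - k)%:R).

(** Selberg's multiplicative function [w / (p - w)] for [w = k] removed classes modulo [p]. *)
Definition sieve_g (R : realFieldType) (k p : nat) : R := k%:R / (p - k)%:R.

(** The condition [2 k <= p] gives [k / (p - k) <= 1], so that [sieve_phi] is bounded by [1]. *)
Definition sifting_prime (k : nat) (bad : nat -> nat -> bool) (p : nat) : Prop :=
  [/\ prime p, (2 * k <= p)%N, forall t, bad p (t + p)%N = bad p t &
     (\sum_(0 <= t < p) bad p t)%N = k].

Lemma sieve_phi_norm (R : realFieldType) (k : nat) bad (p t : nat) :
  sifting_prime k bad p -> `|sieve_phi R k bad p t| <= 1.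
Proof.
case=> p_pr k2p _ _; rewrite /sieve_phi; case: ifP => _; first by rewrite normr1.
have lt : (0 < p - k)%N by have := prime_gt0 p_pr; lia.
rewrite normrN ger0_norm ?divr_ge0 ?ler0n // ler_pdivrMr ?ltr0n // mul1r ler_nat; lia.
Qed.

Lemma sum_sieve_phi (R : realFieldType) (k : nat) bad (p : nat) :
  sifting_prime k bad p -> \sum_(0 <= t < p) sieve_phi R k bad p t = 0.
Proof.
case=> p_pr k2p _ bk.
have lt : (0 < p - k)%N by have := prime_gt0 p_pr; lia.
have -> : \sum_(0 <= t < p) sieve_phi R k bad p t =
  \sum_(0 <= t < p) ((bad p t)%:R * (1 + sieve_g R k p) - sieve_g R k p).
  apply: eq_bigr => t _; rewrite /sieve_phi /sieve_g.
  by case: (bad p t); rewrite ?mul1r ?mul0r ?addrK ?sub0r.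
rewrite big_split /= -mulr_suml -natr_sum bk sumr_const_nat subn0 mulNrn -[_ *+ p]mulr_natl /sieve_g.
have nz : (p - k)%:R != 0 :> R by rewrite pnatr_eq0 -lt0n.
have -> : p%:R = (p - k)%:R + k%:R :> R by rewrite -natrD subnK //; lia.
by field; rewrite nz.
Qed.

Lemma sum_sieve_phi_sq (R : realFieldType) (k : nat) bad (p : nat) :
  sifting_prime k bad p ->
  \sum_(0 <= t < p) sieve_phi R k bad p t ^+ 2 = p%:R * sieve_g R k p.
Proof.
case=> p_pr k2p _ bk.
have lt : (0 < p - k)%N by have := prime_gt0 p_pr; lia.
have -> : \sum_(0 <= t < p) sieve_phi R k bad p t ^+ 2 =
  \sum_(0 <= t < p) ((bad p t)%:R * (1 - sieve_g R k p ^+ 2) + sieve_g R k p ^+ 2).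
  apply: eq_bigr => t _; rewrite /sieve_phi /sieve_g.
  by case: (bad p t); rewrite ?mul1r ?mul0r ?subrK ?add0r ?expr1n ?sqrrN.
rewrite big_split /= -mulr_suml -natr_sum bk sumr_const_nat subn0 -[_ *+ p]mulr_natl /sieve_g.
have nz : (p - k)%:R != 0 :> R by rewrite pnatr_eq0 -lt0n.
have -> : p%:R = (p - k)%:R + k%:R :> R by rewrite -natrD subnK //; lia.
by field; rewrite nz.
Qed.

(** Induction on the primes. Peeling off [p] from both factors gives four terms at levels divided by
    [p] or not, hence two independent levels; the powers of [phi_p] are absorbed into the periodic
    weight [u], whose period becomes [m p]. The two cross terms have mean zero since [p] is coprime
    to [m], and the last one picks up the mean square [sieve_g]. *)
Lemma sieve_quadratic_form_le (R : realFieldType) (k N : nat) bad (P : seq nat) (Q Q' m : nat)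
    (u : nat -> R) (B : R) :
  uniq P -> {in P, forall p, sifting_prime k bad p /\ coprime m p} ->
  (0 < m)%N -> (forall t, u (t + m)%N = u t) -> (forall t, `|u t| <= B) ->
  \sum_(0 <= t < N) u t * (tprod P (fun p => - sieve_phi R k bad p t) Q
                           * tprod P (fun p => - sieve_phi R k bad p t) Q') <=
  N%:R / m%:R * (\sum_(0 <= t < m) u t) * tprod P (sieve_g R k) (minn Q Q')
  + 2 * m%:R * B * (tprod P (fun p => p%:R) Q * tprod P (fun p => p%:R) Q').
Proof.
elim: P Q Q' m u B => [|p P IH] Q Q' m u B /=.
  move=> _ _ m0 um uB.
  have -> : (0 < minn Q Q')%N = (0 < Q)%N && (0 < Q')%N by rewrite leq_min.
  case: (0 < Q)%N; case: (0 < Q')%N => /=;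
    under eq_bigr do rewrite ?(mulr1, mulr0, mul0r);
    rewrite ?big1_eq ?(mulr0, mul0r, addr0) // ?mulr1.
  exact: sum_periodic_le.
case/andP=> pP uP Pok m0 um uB.
have [sp cop] := Pok p (mem_head _ _).
have [p_pr k2p bp bk] := sp.
have p0 := prime_gt0 p_pr.
have PokP : {in P, forall q, sifting_prime k bad q /\ coprime m q}.
  by move=> q qP; apply: Pok; rewrite inE qP orbT.
have PokPp : {in P, forall q, sifting_prime k bad q /\ coprime (m * p) q}.
  move=> q qP; have [sq cq] := PokP q qP; split=> //; rewrite coprimeMl cq /=.
  have [q_pr _ _ _] := sq.
  rewrite prime_coprime // dvdn_prime2 //; apply: contraNN pP => /eqP ->; exact: qP.
pose phi := sieve_phi R k bad p.
pose F n t := tprod P (fun p => - sieve_phi R k bad p t) n.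
have phip t : phi (t + p)%N = phi t by rewrite /phi /sieve_phi bp.
have phin (t : nat) : `|phi t| <= 1 by exact: sieve_phi_norm.
have B0 : 0 <= B by apply: le_trans (uB 0%N).
have per_p (v : nat -> R) t : (forall t, v (t + p)%N = v t) -> v (t + m * p)%N = v t.
  by move=> vp; rewrite mulnC periodic_addM.
have per_u t : u (t + m * p)%N = u t.
  exact: periodic_addM.
have mp0 : (0 < m * p)%N by rewrite muln_gt0 m0.
pose u1 t := - (u t * phi t); pose u2 t := u t * phi t ^+ 2.
have u1p t : u1 (t + m * p)%N = u1 t by rewrite /u1 per_u (per_p _ _ phip).
have u2p t : u2 (t + m * p)%N = u2 t by rewrite /u2 per_u (per_p _ _ phip).
have u1B t : `|u1 t| <= B.
  by rewrite /u1 normrN normrM -[B]mulr1 ler_pM.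
have u2B t : `|u2 t| <= B.
  by rewrite /u2 normrM normrX -[B]mulr1 ler_pM ?exprn_ge0 ?exprn_ile1.
have s1 : \sum_(0 <= t < m * p) u1 t = 0.
  rewrite /u1 sumrN (sum_coprime_periodic p0 cop um phip) /phi sum_sieve_phi //.
  by rewrite mulr0 oppr0.
have s2 : \sum_(0 <= t < m * p) u2 t =
    (\sum_(0 <= t < m) u t) * (p%:R * sieve_g R k p).
  rewrite /u2 (@sum_coprime_periodic _ m p u (fun t => phi t ^+ 2)) //;
    last by move=> t; rewrite phip.
  by rewrite /phi sum_sieve_phi_sq.
have T0 := IH Q Q' m u B uP PokP m0 um uB.
have T1 := IH (Q %/ p)%N Q' _ u1 B uP PokPp mp0 u1p u1B.
have T2 := IH Q (Q' %/ p)%N _ u1 B uP PokPp mp0 u1p u1B.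
have T3 := IH (Q %/ p)%N (Q' %/ p)%N _ u2 B uP PokPp mp0 u2p u2B.
rewrite s1 mulr0 mul0r add0r in T1; rewrite s1 mulr0 mul0r add0r in T2.
rewrite s2 natrM in T3; rewrite natrM in T1; rewrite natrM in T2.
have -> : \sum_(0 <= t < N) u t * ((tprod P (fun p => - sieve_phi R k bad p t) Q +
     - sieve_phi R k bad p t * tprod P (fun p => - sieve_phi R k bad p t) (Q %/ p)) *
    (tprod P (fun p => - sieve_phi R k bad p t) Q' +
     - sieve_phi R k bad p t * tprod P (fun p => - sieve_phi R k bad p t) (Q' %/ p))) =
   \sum_(0 <= t < N) u t * (F Q t * F Q' t)
 + \sum_(0 <= t < N) u1 t * (F (Q %/ p)%N t * F Q' t)
 + \sum_(0 <= t < N) u1 t * (F Q t * F (Q' %/ p)%N t)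
 + \sum_(0 <= t < N) u2 t * (F (Q %/ p)%N t * F (Q' %/ p)%N t).
  rewrite -!big_split /=; apply: eq_bigr => t _.
  by rewrite /u1 /u2 /F /phi; ring.
have -> : (minn Q Q' %/ p = minn (Q %/ p) (Q' %/ p))%N.
  case: (leqP Q Q') => le; first by rewrite (minn_idPl _) ?leq_div2r.
  by rewrite (minn_idPr _) // leq_div2r // ltnW.
rewrite -!/(F _ _) in T0 T1 T2 T3 *.
have mR : m%:R != 0 :> R by rewrite pnatr_eq0 -lt0n.
have pR : p%:R != 0 :> R by rewrite pnatr_eq0 -lt0n.
have eqm : N%:R / (m%:R * p%:R) * ((\sum_(0 <= t < m) u t) * (p%:R * sieve_g R k p)) =
  N%:R / m%:R * (\sum_(0 <= t < m) u t) * sieve_g R k p.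
  by field; rewrite mR pR.
rewrite {}eqm in T3.
set E := tprod P (fun p => p%:R) in T0 T1 T2 T3 *.
have E0 n : 0 <= E n by apply: tprod_ge0 => q _; exact: ler0n.
(* In the term with [phi_p ^ 2] the period grows by [p] only, while the claimed error allows
   [p ^ 2]. *)
have e3 : 2 * (m%:R * p%:R) * B * (E (Q %/ p)%N * E (Q' %/ p)%N) <=
   2 * m%:R * B * (p%:R * E (Q %/ p)%N * (p%:R * E (Q' %/ p)%N)).
  have -> : 2 * m%:R * B * (p%:R * E (Q %/ p)%N * (p%:R * E (Q' %/ p)%N)) =
    2 * (m%:R * p%:R) * B * (E (Q %/ p)%N * E (Q' %/ p)%N) * p%:R by ring.
  by rewrite ler_peMr ?ler1n // !mulr_ge0 ?ler0n.
apply: le_trans (lerD (lerD (lerD T0 T1) T2) T3) _.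
move: e3; set X := \sum_(0 <= t < m) u t; set g := sieve_g R k p; set l1 := tprod _ _ _.
set l2 := tprod P (sieve_g R k) _.
move=> e3.
rewrite -subr_ge0 in e3; rewrite -subr_ge0.
apply: le_trans e3 _; apply: eq_ler; ring.
Qed.

(** * The sieve bound and smooth harmonic sums *)

(** At every [t] in [A] all [- phi_p(t)] equal [sieve_g], so [F(t) = L]. Comparing [L ^ 2] times the
    count with [sum_t F(t) ^ 2], bounded by the quadratic form, and dividing by [L >= 1] gives the
    claim. *)
Lemma sieve_upper_bound (R : realFieldType) (k N Q : nat) bad (P : seq nat) (A : pred nat) :
  (0 < Q)%N -> uniq P -> {in P, forall p, sifting_prime k bad p} ->
  (forall t, A t -> {in P, forall p, ~~ bad p t}) ->
  (\sum_(0 <= t < N) A t)%N%:R * tprod P (sieve_g R k) Q <=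
  N%:R + 2 * tprod P (fun p => p%:R) Q ^+ 2.
Proof.
move=> Q0 uP Pok AP.
set L := tprod P _ Q; set E := tprod P _ Q.
have L1 : 1 <= L by apply: tprod_ge1 => // p _; rewrite divr_ge0 ?ler0n.
have Pok1 : {in P, forall p, sifting_prime k bad p /\ coprime 1 p}.
  by move=> p pP; split; [exact: Pok|rewrite coprime1n].
have norm1 (t : nat) : `|1 : R| <= 1 by rewrite normr1.
have := @sieve_quadratic_form_le R k N bad P Q Q 1 (fun=> 1) 1 uP Pok1 isT (fun=> erefl) norm1.
rewrite big_nat1 divr1 !mulr1 minnn -/L -/E => H.
have L0 : 0 < L by apply: lt_le_trans L1.
have e : (\sum_(0 <= t < N) A t)%N%:R * L ^+ 2 <= N%:R * L + 2 * (E * E).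
  apply: le_trans H; rewrite natr_sum mulr_suml; apply: ler_sum => t _; rewrite mul1r.
  case At : (A t); last by rewrite mul0r -expr2 sqr_ge0.
  rewrite mul1r -expr2 /L (@eq_in_tprod _ _ _ (fun p => - sieve_phi R k bad p t)) //.
  by move=> p pP; rewrite /sieve_phi (negbTE (AP _ At p pP)) opprK.
rewrite -(ler_pM2r L0) mulrDl -mulrA -expr2; apply: le_trans e _.
by rewrite lerD2l -expr2 ler_peMr // mulr_ge0 // sqr_ge0.
Qed.

(** Bernoulli's inequality [1 + c x <= (1 + x) ^ c] reduces to [c = 1], where the product over all
    integers from [2] on stays below [2]. *)
Lemma prod_inv_sq_le (R : realFieldType) (c M : nat) (a : pred nat) :
  \prod_(2 <= p < M | a p) (1 + c%:R / p%:R ^+ 2) <= 2 ^+ c :> R.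
Proof.
have pos p : 0 <= c%:R / p%:R ^+ 2 :> R by rewrite divr_ge0 ?exprn_ge0 ?ler0n.
have pos1 p : 0 <= p%:R ^- 2 :> R by rewrite invr_ge0 ?exprn_ge0 ?ler0n.
apply: le_trans (_ : \prod_(2 <= p < M) (1 + c%:R / p%:R ^+ 2) <= _).
  rewrite big_mkcond /=; apply: ler_prod => p _; case: ifP => _.
    by rewrite lexx andbT addr_ge0.
  by rewrite ler01 lerDl pos.
apply: le_trans (_ : \prod_(2 <= p < M) (1 + p%:R ^- 2) ^+ c <= _).
  apply: ler_prod => p _; rewrite addr_ge0 //= -/(_ / _).
  move: (p%:R ^- 2) (pos1 p) => x x0.
  elim: c {pos} => [|c IH]; first by rewrite mul0r addr0.
  rewrite exprS; apply: (le_trans _ (ler_wpM2l (_ : 0 <= 1 + x) IH)); last by rewrite addr_ge0.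
  rewrite -natr1 mulrDl mul1r.
  have := mulr_ge0 (mulr_ge0 (ler0n R c) x0) x0.
  by set y := c%:R; nra.
rewrite prodrXl lerXn2r ?nnegrE ?prodr_ge0 //.
case: (leqP M 2) => [M2|M2]; first by rewrite big_geq // ler1n.
(* This sharper bound is closed under induction, and it increases to [2]. *)
suff H n : \prod_(2 <= p < n.+2) (1 + p%:R ^- 2) <= 2 * n.+1%:R / n.+2%:R :> R.
  case: M M2 => // -[//|M] _; apply: le_trans (H M) _.
  by rewrite -mulrA ler_piMr // ler_pdivrMr ?ltr0n // mul1r ler_nat.
elim: n => [|n IH]; first by rewrite big_geq // mulr1 divff ?pnatr_eq0.
rewrite big_nat_recr //=; apply: le_trans (ler_wpM2r _ IH) _; first by rewrite addr_ge0.
have [-> -> ->] : [/\ n.+3%:R = n%:R + 3 :> R, n.+2%:R = n%:R + 2 :> R & n.+1%:R = n%:R + 1 :> R].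
  by rewrite -!natr1; split; lra.
have n0 := ler0n R n; set x := n%:R in n0 *.
have x2 : x + 2 != 0 by apply/lt0r_neq0; lra.
have x3 : x + 3 != 0 by apply/lt0r_neq0; lra.
rewrite -subr_ge0.
have -> : 2 * (x + 2) / (x + 3) - 2 * (x + 1) / (x + 2) * (1 + (x + 2) ^- 2) =
  2 / ((x + 3) * (x + 2) ^+ 3) by field; rewrite x2 x3.
by rewrite divr_ge0 // mulr_ge0 ?exprn_ge0 //; lra.
Qed.

Lemma natr_div_le (R : realFieldType) (n p : nat) : (n %/ p)%N%:R <= n%:R / p%:R :> R.
Proof.
case: (posnP p) => [->|p0]; first by rewrite divn0 divr_ge0.
by rewrite ler_pdivlMr ?ltr0n // -natrM ler_nat leq_divM.
Qed.

(** Rankin's trick: [d <= Q] gives [d <= Q ^ 3 / d ^ 2], and the sum of the [1 / d ^ 2] is at most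
    an Euler product. *)
Lemma tprod_natr_le (R : realFieldType) (P : seq nat) (Q : nat) :
  tprod P (fun p => p%:R) Q <= Q%:R ^+ 3 * \prod_(p <- P) (1 + 1 / p%:R ^+ 2) :> R.
Proof.
elim: P Q => [|p P IH] Q /=.
  by rewrite big_nil mulr1 -natrX ler_nat; case: Q.
have pos : 0 <= \prod_(p <- P) (1 + 1 / p%:R ^+ 2) :> R.
  by apply: prodr_ge0 => q _; rewrite addr_ge0 ?divr_ge0 ?exprn_ge0.
rewrite big_cons mulrCA mulrDl [1 * (_ * _)]mul1r lerD ?IH //.
case: (posnP p) => [->|p0]; first by rewrite mul0r !mulr_ge0 ?invr_ge0 ?exprn_ge0.
apply: le_trans (ler_wpM2l _ (IH _)) _; first exact: ler0n.
rewrite [leLHS]mulrA [leRHS]mulrA ler_wpM2r //.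
have pR : p%:R != 0 :> R by rewrite pnatr_eq0 -lt0n.
have -> : 1 / p%:R ^+ 2 * Q%:R ^+ 3 = p%:R * (Q%:R / p%:R) ^+ 3 :> R by field.
by rewrite ler_wpM2l // lerXn2r ?nnegrE ?divr_ge0 // natr_div_le.
Qed.

Lemma big_nat_multiples (R : nmodType) (F : nat -> R) (p Y : nat) (a : pred nat) : (0 < p)%N ->
  \sum_(1 <= n < Y.+1 | (p %| n)%N && a n) F n =
  \sum_(1 <= m < (Y %/ p)%N.+1 | a (p * m)%N) F (p * m)%N.
Proof.
move=> p0; rewrite -(big_map (muln p) a F) big_mkcondl /= -big_mkcondl -big_filter_cond.
apply: perm_big; apply: uniq_perm.
- by rewrite filter_uniq // iota_uniq.
- by rewrite map_inj_uniq ?iota_uniq // => x y /eqP; rewrite eqn_pmul2l // => /eqP.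
move=> n; rewrite mem_filter mem_index_iota; apply/andP/mapP => [[/dvdnP[m ->] /andP[n1 n2]]|].
  exists m; last by rewrite mulnC.
  by rewrite mem_index_iota ltnS leq_divRL //; case: m n1 n2.
case=> m; rewrite mem_index_iota => /andP[m1 m2] ->.
rewrite dvdn_mulr // muln_gt0 p0 m1 ltnS; split=> //.
by rewrite mulnC -leq_divRL.
Qed.

Definition smooth_sum (R : realFieldType) (a : pred nat) (Y : nat) : R :=
  \sum_(1 <= n < Y.+1 | all a (primes n)) n%:R^-1.

Lemma smooth_sum_ge0 (R : realFieldType) (a : pred nat) (Y : nat) : 0 <= smooth_sum R a Y.
Proof. by apply: sumr_ge0 => n _; rewrite invr_ge0. Qed.

Lemma smooth_sum_le (R : realFieldType) (a : pred nat) (Y Y' : nat) :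
  (Y <= Y')%N -> smooth_sum R a Y <= smooth_sum R a Y'.
Proof.
move=> le; rewrite /smooth_sum [leRHS](big_cat_nat (n := Y.+1)) //= lerDl.
by apply: sumr_ge0 => n _; rewrite invr_ge0.
Qed.

(** The [n] prime to [p] are counted by [a]; the others are [n = p m] with [m <= Y / p], where [m]
    may still be divisible by [p]. *)
Lemma smooth_sum_step (R : realFieldType) (a b : pred nat) (p Y : nat) : prime p ->
  (forall q, b q -> q != p -> a q) ->
  smooth_sum R b Y <= smooth_sum R a Y + p%:R^-1 * smooth_sum R b (Y %/ p).
Proof.
move=> p_pr ba; have p0 := prime_gt0 p_pr.
rewrite {1}/smooth_sum (bigID (fun n => p %| n)%N) /= addrC lerD //.
  rewrite big_mkcond [leRHS]big_mkcond /= big_nat [leRHS]big_nat.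
  apply: ler_sum => n /andP[n1 _]; case: ifP => [/andP[alb pn]|_].
    suff -> : all a (primes n) by [].
    apply/allP => q qn; apply: ba; first exact: (allP alb).
    by apply: contraNneq pn => <-; move: qn; rewrite mem_primes => /and3P[].
  by case: ifP => // _; rewrite invr_ge0.
under eq_bigl do rewrite andbC.
rewrite big_nat_multiples // /smooth_sum mulr_sumr.
rewrite big_mkcond [leRHS]big_mkcond /= big_nat [leRHS]big_nat.
apply: ler_sum => n /andP[n1 _]; case: ifP => [alb|_].
  suff -> : all b (primes n) by rewrite natrM invfM.
  apply/allP => q; rewrite mem_primes => /and3P[q_pr _ qn]; apply: (allP alb).
  by rewrite mem_primes q_pr muln_gt0 p0 n1 dvdn_mull.
by case: ifP => // _; rewrite mulr_ge0 ?invr_ge0.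
Qed.

(** Charge each [n] to its radical, which is still at most [Y]. By the geometric series
    [1 / (p - 1) = sum_(j >= 1) p ^ (- j)], the weight of a squarefree number covers all [n] with
    that radical. *)
Lemma tprod_ge_smooth_sum (R : realFieldType) (P : seq nat) (Y : nat) :
  {in P, forall p, prime p} ->
  smooth_sum R (mem P) Y <= tprod P (fun p => (p%:R - 1)^-1) Y.
Proof.
elim: P Y => [|p P IH] Y Pp /=.
  case: Y => [|Y] /=; first by rewrite /smooth_sum big_geq.
  rewrite /smooth_sum big_ltn_cond //= big_nat_cond big1 ?addr0 ?invr1 //.
  move=> n /andP[/andP[n1 _]]; move/allP => H; exfalso.
  have : pdiv n \in primes n by rewrite mem_primes pdiv_prime // pdiv_dvd ltnW.
  by move/H; rewrite inE.
have p_pr := Pp p (mem_head _ _); have p1 := prime_gt1 p_pr.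
have PP : {in P, forall q, prime q} by move=> q qP; apply: Pp; rewrite inE qP orbT.
have p1R : 0 < p%:R - 1 :> R by rewrite subr_gt0 ltr1n.
have tpos n : 0 <= tprod P (fun p => (p%:R - 1)^-1 : R) n.
  apply: tprod_ge0 => q /PP q_pr; rewrite invr_ge0 subr_ge0 ler1n.
  exact: prime_gt0.
(* Repeated factors [p] lead back to the same list [p :: P] at level [Y %/ p], hence a second
   induction, on the level. *)
elim/ltn_ind: Y => Y IHY.
have [->|Y0] := posnP Y.
  rewrite {1}/smooth_sum big_geq // div0n addr_ge0 ?mulr_ge0 ?tpos // invr_ge0.
  exact: ltW.
have st : forall q, q \in p :: P -> q != p -> q \in P.
  by move=> q; rewrite inE => /orP[->|].
apply: le_trans (smooth_sum_step R Y p_pr st) _; rewrite lerD ?IH //.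
have lt : (Y %/ p < Y)%N by rewrite ltn_Pdiv.
have pinv : 0 <= p%:R^-1 :> R by rewrite invr_ge0.
apply: le_trans (ler_wpM2l pinv (IHY _ lt)) _.
have mono : tprod P (fun p => (p%:R - 1)^-1 : R) ((Y %/ p) %/ p) <=
   tprod P (fun p => (p%:R - 1)^-1) (Y %/ p).
  apply: tprod_le_level; last exact: leq_div.
  move=> q /PP q_pr; rewrite invr_ge0 subr_ge0 ler1n; exact: prime_gt0.
have c0 : 0 <= (p%:R - 1)^-1 :> R by rewrite invr_ge0 ltW.
have pR : p%:R != 0 :> R by rewrite pnatr_eq0; lia.
have -> : (p%:R - 1)^-1 * tprod P (fun p => (p%:R - 1)^-1) (Y %/ p) =
  p%:R^-1 * (tprod P (fun p => (p%:R - 1)^-1) (Y %/ p) +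
  (p%:R - 1)^-1 * tprod P (fun p => (p%:R - 1)^-1) (Y %/ p)) :> R.
  by field; rewrite pR gt_eqF.
by rewrite ler_wpM2l // lerD2l ler_wpM2l.
Qed.

(** Dropping one prime [p] costs at most [(1 - 1 / p) ^ (-1)]: the step inequality gives
    [Sb <= Sc + Sb / p]. *)
Lemma smooth_sum_remove (R : realFieldType) (a b : pred nat) (B : seq nat) (Y : nat) :
  {in B, forall p, prime p} -> (forall q, b q -> (q \in B) || a q) ->
  smooth_sum R b Y <= (\prod_(p <- B) (p%:R / (p%:R - 1))) * smooth_sum R a Y.
Proof.
elim: B b => [|p B IH] b Bp ba.
  rewrite big_nil mul1r /smooth_sum big_mkcond [leRHS]big_mkcond /=.
  apply: ler_sum => n _; case: ifP => [alb|_]; last by case: ifP => // _; rewrite invr_ge0.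
  suff -> : all a (primes n) by [].
  by apply/allP => q /(allP alb); exact: ba.
have p_pr := Bp p (mem_head _ _); have p1 := prime_gt1 p_pr.
have BP : {in B, forall q, prime q} by move=> q qP; apply: Bp; rewrite inE qP orbT.
have p1R : 0 < p%:R - 1 :> R by rewrite subr_gt0 ltr1n.
pose c q := (q \in B) || a q.
have bc q : b q -> q != p -> c q.
  by move=> /ba; rewrite inE -orbA => /orP[->|].
have := smooth_sum_step R Y p_pr bc.
have pinv : 0 <= p%:R^-1 :> R by rewrite invr_ge0.
have := ler_wpM2l pinv (smooth_sum_le R b (leq_div Y p)).
have := IH c BP (fun q h => h).
rewrite big_cons -[_ * _ * smooth_sum R a Y]mulrA; set T := _ * smooth_sum R a Y.
set Sb := smooth_sum R b Y; set Sc := smooth_sum R c Y => h1 h2 h3.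
have pR : 0 < p%:R :> R by rewrite ltr0n; lia.
have h4 : Sb <= T + p%:R^-1 * Sb by lra.
rewrite -(ler_pM2l p1R).
have -> : (p%:R - 1) * (p%:R / (p%:R - 1) * T) = p%:R * T by field; rewrite gt_eqF.
have := ler_wpM2l (ltW pR) h4.
have -> : p%:R * (T + p%:R^-1 * Sb) = p%:R * T + Sb by field; rewrite gt_eqF.
by lra.
Qed.

(** Multiply [k] copies of the bound for weight [1 / (p - 1)] at level [Y]. Since
    [1 + sieve_g j p = (1 - j / p) ^ (-1)], the condition of [tprodM_le] amounts to [(1 - j / p) (1
    - 1 / p) >= 1 - (j + 1) / p]. *)
Lemma tprod_sieve_g_ge (R : realFieldType) (k : nat) (P : seq nat) (Y : nat) :
  {in P, forall p, prime p && (2 * k <= p)%N} -> (0 < Y)%N ->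
  smooth_sum R (mem P) Y ^+ k <= tprod P (sieve_g R k) (Y ^ k)%N.
Proof.
move=> Pk Y0.
have Pp : {in P, forall p, prime p} by move=> p /Pk /andP[].
suff H j : (j <= k)%N -> smooth_sum R (mem P) Y ^+ j <= tprod P (sieve_g R j) (Y ^ j)%N.
  exact: H.
elim: j => [|j IH] jk.
  by rewrite expr0 expn0; apply: tprod_ge1 => // p _; rewrite divr_ge0.
rewrite exprSr expnSr.
have tpos n : 0 <= tprod P (sieve_g R j) n by apply: tprod_ge0 => p _; rewrite divr_ge0.
apply: le_trans (ler_pM _ _ (IH (ltnW jk)) (tprod_ge_smooth_sum R Y Pp)) _.
- by rewrite exprn_ge0 // smooth_sum_ge0.
- exact: smooth_sum_ge0.
apply: tprodM_le => p /Pk /andP[p_pr kp].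
have p1 := prime_gt1 p_pr.
have p1R : 0 < p%:R - 1 :> R by rewrite subr_gt0 ltr1n.
rewrite /sieve_g; split; [by rewrite divr_ge0|by rewrite invr_ge0 ltW|].
have jR : (p - j)%N%:R = p%:R - j%:R :> R by rewrite natrB //; lia.
have jR1 : (p - j.+1)%N%:R = p%:R - j%:R - 1 :> R by rewrite natrB -?natr1; [lra|lia].
have h1 : 0 < p%:R - j%:R - 1 :> R by rewrite -jR1 ltr0n; lia.
rewrite jR jR1 -natr1.
have j0 := ler0n R j.
move: p1R h1 j0; set x := p%:R; set y := j%:R => p1R h1 j0.
have e1 : x - y != 0 by apply/lt0r_neq0; lra.
have e2 : x - 1 != 0 by apply/lt0r_neq0; lra.
have e3 : x - y - 1 != 0 by apply/lt0r_neq0; lra.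
rewrite -subr_ge0.
have -> : (y + 1) / (x - y - 1) - (y / (x - y) + (x - 1)^-1 + y / (x - y) * (x - 1)^-1) =
  x * y / ((x - y - 1) * (x - y) * (x - 1)) by field; rewrite e1 e2 e3.
by rewrite divr_ge0 // !mulr_ge0 //; lra.
Qed.

(** * Exceptional primes of a tuple and their moments *)

Lemma prodr_ge_one (R : realFieldType) (I : Type) (r : seq I) (P : pred I) (F : I -> R) :
  (forall i, P i -> 1 <= F i) -> 1 <= \prod_(i <- r | P i) F i.
Proof.
move=> F1; elim/big_rec: _ => // i x Pi x1.
by apply: (le_trans x1); rewrite ler_peMl ?F1 // (le_trans ler01).
Qed.

Lemma ler_prod_sub (R : realFieldType) (I : Type) (r : seq I) (P P' : pred I) (F : I -> R) :
  (forall i, P i -> P' i) -> (forall i, P' i -> 1 <= F i) ->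
  \prod_(i <- r | P i) F i <= \prod_(i <- r | P' i) F i.
Proof.
move=> PP' F1; rewrite big_mkcond [leRHS]big_mkcond /=; apply: ler_prod => i _.
case: ifP => [/PP' Pi|_]; first by rewrite Pi lexx (le_trans ler01 (F1 _ Pi)).
by rewrite ler01 /=; case: ifP => [Pi|_] //; exact: F1.
Qed.

Lemma prime_ratio_ge1 (R : realFieldType) (p : nat) :
  (1 < p)%N -> 1 <= p%:R / (p%:R - 1) :> R.
Proof.
move=> p1; have p1R : 0 < p%:R - 1 :> R by rewrite subr_gt0 ltr1n.
by rewrite ler_pdivlMr // mul1r gerBl.
Qed.

(** For distinct [a, b < X] this is [h(a - b)], since the primes dividing the difference are below
    [X]; for [a = b] it runs over all primes below [X]. *)
Definition pair_factor (R : realFieldType) (X a b : nat) : R :=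
  \prod_(2 <= p < X | prime p && (a == b %[mod p])) (p%:R / (p%:R - 1)).

Lemma pair_factor_ge1 (R : realFieldType) (X a b : nat) : 1 <= pair_factor R X a b.
Proof. by apply: prodr_ge_one => p /andP[/prime_gt1 p1 _]; exact: prime_ratio_ge1. Qed.

Definition sieving_prime (k : nat) (y : 'I_k -> nat) (p : nat) : bool :=
  [&& prime p, (2 * k <= p)%N &
   [forall i, forall j, (i != j) ==> (y i != y j %[mod p])]].

(** A prime that is not sieving is below [2 k] or divides some [y i - y j] with [i != j], so it
    occurs on the right; all surplus factors there are at least [1]. *)
Lemma nonsieving_prod_le (R : realFieldType) (k X X' : nat) (y : 'I_k -> nat) : (X' <= X)%N ->
  \prod_(2 <= p < X' | prime p && ~~ sieving_prime y p) (p%:R / (p%:R - 1)) <=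
  (\prod_(2 <= p < 2 * k) (p%:R / (p%:R - 1))) *
  \prod_(ij : 'I_k * 'I_k | ij.1 != ij.2) pair_factor R X (y ij.1) (y ij.2).
Proof.
move=> leX.
pose w p : R := p%:R / (p%:R - 1).
have w1 p : (1 < p)%N -> 1 <= w p by exact: prime_ratio_ge1.
have w0 p : (1 < p)%N -> 0 <= w p by move=> /w1; apply: le_trans.
have small : \prod_(2 <= p < X' | (p < 2 * k)%N) w p <= \prod_(2 <= p < 2 * k) w p.
  have [le|lt] := leqP X' (2 * k).
    rewrite (big_nat_widen _ _ _ _ _ le) big_nat_cond [leRHS]big_nat_cond.
    apply: ler_prod_sub => p; first by move=> /andP[-> _].
    by rewrite andbT => /andP[/w1].
  by rewrite [leRHS](big_nat_widen _ _ _ _ _ (ltnW lt)).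
pose cg (ij : 'I_k * 'I_k) p := prime p && (y ij.1 == y ij.2 %[mod p]).
have pairs : \prod_(2 <= p < X') \prod_(ij : 'I_k * 'I_k | ij.1 != ij.2)
    (if cg ij p then w p else 1) <=
  \prod_(ij : 'I_k * 'I_k | ij.1 != ij.2) pair_factor R X (y ij.1) (y ij.2).
  rewrite exchange_big /=; apply: ler_prod => ij _.
  rewrite -big_mkcond /pair_factor -/(cg ij) /=; apply/andP; split.
    by apply: prodr_ge0 => p /andP[/prime_gt1 /w0].
  rewrite (big_nat_widen _ _ _ _ _ leX); apply: ler_prod_sub => p; first by case/andP.
  by move=> /andP[/prime_gt1 /w1].
apply: le_trans (ler_pM _ _ small pairs).
- rewrite big_mkcond [X in X * _]big_mkcond -big_split /= big_nat [leRHS]big_nat.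
  apply: ler_prod => p /andP[p2 _].
  have e1 : 1 <= \prod_(ij : 'I_k * 'I_k | ij.1 != ij.2) (if cg ij p then w p else 1).
    by apply: prodr_ge_one => ij _; case: ifP => // _; exact: w1.
  have e2 : 1 <= (if (p < 2 * k)%N then w p else 1) by case: ifP => // _; exact: w1.
  have e0 := le_trans ler01 e1; have e0' := le_trans ler01 e2.
  case: ifP => [/andP[p_pr]|_]; last first.
    by rewrite ler01 /=; exact: le_trans e2 (ler_peMr e0' e1).
  rewrite w0 //= /sieving_prime p_pr /=.
  case: ltnP => [lt _|le]; first by rewrite ler_peMr ?w0.
  rewrite /= mul1r negb_forall => /existsP[i]; rewrite negb_forall => /existsP[j].
  rewrite negb_imply negbK => /andP[ij yij].
  rewrite (bigD1 (i, j)) //= /cg p_pr yij /= ler_peMr ?w0 //.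
  by apply: prodr_ge_one => ij' _; case: ifP => // _; exact: w1.
- by rewrite big_nat_cond; apply: prodr_ge0 => p /andP[/andP[/w0]].
- rewrite big_nat_cond; apply: prodr_ge0 => p /andP[/andP[p2 _] _].
  by apply: prodr_ge0 => ij _; case: ifP => // _; exact: w0.
Qed.

Lemma sieving_prime_sifting (k N : nat) (y : 'I_k -> nat) (p : nat) :
  sieving_prime y p ->
  sifting_prime k (fun p t => [exists i, t + N == y i %[mod p]]) p.
Proof.
case/and3P=> p_pr kp /forallP yp; have p0 := prime_gt0 p_pr.
split=> //; first by move=> t; apply: eq_existsb => i; rewrite addnAC modnDr.
(* [h i] is the class of [y i - N], with [p - N %% p] in place of [- N]. These classes are exactly
   the bad ones, and they are distinct because the [y i] are distinct modulo [p]. *)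
pose h (i : 'I_k) : 'I_p := Ordinal (ltn_pmod (y i + (p - N %% p)) p0).
have hN (i : 'I_k) : h i + N = y i %[mod p].
  have e : (p - N %% p + N = (N %/ p).+1 * p)%N.
    by have := divn_eq N p; have := ltn_pmod N p0; rewrite mulSn; lia.
  by rewrite /h /= modnDml -addnA e addnC modnMDl.
have hP (t : 'I_p) : [exists i, t + N == y i %[mod p]] = (t \in [set h i | i : 'I_k]) :> bool.
  apply/existsP/imsetP => [[i /eqP ti]|[i _ ->]]; exists i => //; last by rewrite hN.
  apply/val_inj; have : (t + N == h i + N %[mod p]) by rewrite hN ti.
  by rewrite eqn_modDr !modn_small // => /eqP.
rewrite big_mkord.
under eq_bigr do rewrite hP.
rewrite -big_mkcond sum1_card card_imset ?card_ord // => i j hij.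
apply/eqP; apply: contraT => nij.
have := implyP (forallP (yp i) j) nij.
by rewrite -!hN hij eqxx.
Qed.

Lemma sum_shifted_range_le (c y Q N : nat) :
  (\sum_(0 <= t < N) (0 < c + t - y <= Q) <= Q)%N.
Proof.
(* The second bound drives the induction: if the last [t] is counted, the count is at most the value
   [c + t - y], itself at most [Q]. *)
suff : (\sum_(0 <= t < N) (0 < c + t - y <= Q) <= minn Q (c + N - 1 - y))%N by lia.
elim: N => [|N IH]; first by rewrite big_geq.
rewrite big_nat_recr //=; case: (boolP (0 < c + N - y <= Q)%N) => h /=; lia.
Qed.

(** Expanding the product over subsets of [P] with product [d], the term of [d] is counted for the
    at most [X / d] multiples of [d]. The induction treats one prime at a time. *)
Lemma moment_prime_factors (R : realFieldType) (P : seq nat) (c : nat -> R) (X : nat) :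
  uniq P -> {in P, forall p, prime p} -> {in P, forall p, 0 <= c p} ->
  \sum_(1 <= n < X.+1) \prod_(p <- P | (p %| n)%N) (1 + c p) <=
  X%:R * \prod_(p <- P) (1 + c p / p%:R).
Proof.
elim: P X => [|q P IH] X /=.
  move=> _ _ _; rewrite big_nil mulr1.
  under eq_bigr do rewrite big_nil.
  by rewrite sumr_const_nat subn1.
case/andP=> qP uP Pp c0.
have q_pr := Pp q (mem_head _ _); have q0 := prime_gt0 q_pr.
have cq := c0 q (mem_head _ _).
have PP : {in P, forall p, prime p} by move=> p pP; apply: Pp; rewrite inE pP orbT.
have cP : {in P, forall p, 0 <= c p} by move=> p pP; apply: c0; rewrite inE pP orbT.
pose G n : R := \prod_(p <- P | (p %| n)%N) (1 + c p).
have -> : \sum_(1 <= n < X.+1) \prod_(p <- q :: P | (p %| n)%N) (1 + c p) =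
  \sum_(1 <= n < X.+1) G n + c q * \sum_(1 <= n < X.+1 | (q %| n)%N && true) G n.
  rewrite mulr_sumr [X in _ + X]big_mkcond -big_split /=; apply: eq_bigr => n _.
  rewrite big_cons andbT -/(G n); case: ifP => _; last by rewrite addr0.
  by rewrite mulrDl mul1r.
rewrite big_nat_multiples //.
have -> : \sum_(1 <= m < (X %/ q)%N.+1) G (q * m)%N = \sum_(1 <= m < (X %/ q)%N.+1) G m.
  apply: eq_bigr => m _; rewrite /G big_seq_cond [RHS]big_seq_cond; apply: eq_bigl => p.
  case pP : (p \in P) => //=; have p_pr := PP p pP.
  by rewrite Gauss_dvdr // prime_coprime // dvdn_prime2 //; apply: contraNneq qP => <-.
rewrite big_cons; have := IH X uP PP cP; have := IH (X %/ q)%N uP PP cP.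
rewrite -/(G _); set T := \prod_(p <- P) _ => h1 h2.
have T0 : 0 <= T.
  by rewrite /T big_seq; apply: prodr_ge0 => p pP; rewrite addr_ge0 ?divr_ge0 ?cP.
have h3 : (X %/ q)%N%:R * T <= X%:R / q%:R * T by rewrite ler_wpM2r // natr_div_le.
have h4 := ler_wpM2l cq (le_trans h1 h3).
apply: le_trans (lerD h2 h4) _.
apply: eq_ler; ring.
Qed.

(** With [x = 1 / (p - 1)], convexity gives [(1 + x) ^ M <= 1 + (2 ^ M - 1) x] for [x] in [[0, 1]],
    and [x <= 2 / p]. *)
Lemma pow_prime_ratio_le (R : realFieldType) (M p : nat) : (1 < p)%N ->
  (p%:R / (p%:R - 1)) ^+ M <= 1 + (2 ^ M.+1)%N%:R / p%:R :> R.
Proof.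
move=> p1; have p1R : 1 <= p%:R - 1 :> R by rewrite lerBrDr (_ : 1 + 1 = 2%:R) ?ler_nat // -natr1.
have -> : p%:R / (p%:R - 1) = 1 + (p%:R - 1)^-1 :> R by field; apply/lt0r_neq0; lra.
set x := (p%:R - 1)^-1.
have x0 : 0 <= x by rewrite invr_ge0; lra.
have x1 : x <= 1 by rewrite invf_le1; lra.
have xp : x <= 2 / p%:R.
  rewrite /x -[_^-1]mul1r ler_pdivrMr; last by lra.
  rewrite mulrAC ler_pdivlMr; last by lra.
  lra.
have h : (1 + x) ^+ M <= 1 + (2 ^+ M - 1) * x.
  elim: M => [|M IH]; first by rewrite !expr0; lra.
  have M1 : 1 <= 2 ^+ M :> R by rewrite exprn_ege1 // ler1n.
  rewrite exprS; apply: le_trans (ler_wpM2l _ IH) _; first by lra.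
  rewrite [2 ^+ M.+1]exprS; set z := 2 ^+ M in M1 *.
  have := mulr_ge0 (mulr_ge0 (_ : 0 <= z - 1) x0) (_ : 0 <= 1 - x); nra.
apply: (le_trans h); apply: (le_trans (_ : _ <= 1 + 2 ^+ M * x)); first by lra.
by rewrite lerD2l expnSr natrM natrX -mulrA ler_wpM2l ?exprn_ge0.
Qed.

(** The excess of each factor is [O(1 / p)], and averaging over multiples of [p] supplies another
    [1 / p], so the Euler product converges. *)
Lemma moment_pair_factor_half (R : realFieldType) (M Z X : nat) :
  \sum_(1 <= n < X.+1)
    (\prod_(2 <= p < Z | prime p && (p %| n)%N) (p%:R / (p%:R - 1))) ^+ M <=
  X%:R * 2 ^+ (2 ^ M.+1) :> R.
Proof.
set P := [seq p <- index_iota 2 Z | prime p].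
have Pp : {in P, forall p, prime p} by move=> p; rewrite mem_filter => /andP[].
have uP : uniq P by rewrite filter_uniq // iota_uniq.
pose c p : R := (2 ^ M.+1)%N%:R / p%:R.
have c0 : {in P, forall p, 0 <= c p} by move=> p _; rewrite divr_ge0.
apply: le_trans (_ : \sum_(1 <= n < X.+1) \prod_(p <- P | (p %| n)%N) (1 + c p) <= _).
  apply: ler_sum => n _; rewrite -big_filter_cond -/P -prodrXl.
  rewrite big_seq_cond [leRHS]big_seq_cond; apply: ler_prod => p /andP[/Pp/prime_gt1 p1 _].
  rewrite pow_prime_ratio_le // andbT exprn_ge0 //.
  exact: le_trans ler01 (prime_ratio_ge1 _ p1).
apply: le_trans (moment_prime_factors X uP Pp c0) _; rewrite ler_wpM2l //.
rewrite big_filter.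
apply: le_trans (prod_inv_sq_le R (2 ^ M.+1) Z prime).
by under eq_bigr do rewrite /c -mulrA -invfM -expr2.
Qed.

Lemma sum_pair_factor_le (R : realFieldType) (M Z X a : nat) : (a < X)%N ->
  \sum_(b < X | (b : nat) != a) pair_factor R Z a b ^+ M <= 2 * X%:R * 2 ^+ (2 ^ M.+1).
Proof.
move=> aX.
pose G n : R := (\prod_(2 <= p < Z | prime p && (p %| n)%N) (p%:R / (p%:R - 1))) ^+ M.
have G0 n : 0 <= G n.
  apply/exprn_ge0/prodr_ge0 => p /andP[/prime_gt1 /(prime_ratio_ge1 R) p1 _].
  exact: le_trans p1.
have mono n : (n <= X)%N -> \sum_(1 <= m < n.+1) G m <= X%:R * 2 ^+ (2 ^ M.+1).
  move=> nX; apply: le_trans (moment_pair_factor_half R M Z n) _.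
  by rewrite ler_wpM2r ?exprn_ge0 // ler_nat.
rewrite -(big_mkord (fun b => b != a) (fun b => pair_factor R Z a b ^+ M)).
rewrite (big_cat_nat (n := a)) //=; last exact: ltnW.
rewrite (big_ltn_cond (m := a)) // eqxx /=.
have -> : 2 * X%:R * 2 ^+ (2 ^ M.+1) = X%:R * 2 ^+ (2 ^ M.+1) + X%:R * 2 ^+ (2 ^ M.+1) :> R.
  by ring.
apply: lerD.
  apply: le_trans (mono a (ltnW aX)).
  rewrite [leRHS]big_add1 /= [leRHS]big_nat_rev /= add0n.
  rewrite big_mkcond /= big_nat [leRHS]big_nat; apply: ler_sum => b /andP[_ ba].
  case: ifP => [_|_ //]; rewrite -subSn // subSS.
  rewrite /pair_factor /G; apply: eq_ler; congr (_ ^+ _).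
  by apply: eq_bigl => p; rewrite eqn_mod_dvd // ltnW.
apply: le_trans (mono (X - a.+1)%N (leq_subr _ _)).
rewrite -{1}[a.+1]add1n big_addn subnS prednK ?subn_gt0 //.
rewrite big_mkcond /= big_nat [leRHS]big_nat; apply: ler_sum => b /andP[b1 _].
case: ifP => [_|_ //].
rewrite /pair_factor /G; apply: eq_ler; congr (_ ^+ _).
apply: eq_bigl => p; congr (_ && _).
by rewrite eq_sym eqn_mod_dvd ?leq_addl // addnK.
Qed.

Lemma sum_ffun_pair (R : realFieldType) (k X : nat) (i j : 'I_k) (Phi : 'I_X -> 'I_X -> R) :
  i != j ->
  \sum_(y : {ffun 'I_k -> 'I_X}) Phi (y i) (y j) =
  X%:R ^+ (k - 2) * \sum_a \sum_b Phi a b.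
Proof.
move=> ij; have ji : j != i by rewrite eq_sym.
(* With [y i] pinned to [c] the summand is a product over coordinates, so the sum factors; each of
   the [k - 2] free coordinates contributes [X]. *)
pose F c (l : 'I_k) (a : 'I_X) : R :=
  if l == i then (a == c)%:R else if l == j then Phi c a else 1.
transitivity (\sum_c \sum_(y : {ffun 'I_k -> 'I_X}) \prod_l F c l (y l)).
  rewrite exchange_big /=; apply: eq_bigr => y _.
  have E c : \prod_l F c l (y l) = (y i == c)%:R * Phi c (y j).
    rewrite (bigD1 i) //= (bigD1 j) //= big1 ?mulr1.
      by rewrite /F eqxx (negbTE ji) eqxx.
    by move=> l /andP[li lj]; rewrite /F (negbTE li) (negbTE lj).
  under eq_bigr do rewrite E.
  rewrite (bigD1 (y i)) //= eqxx mul1r big1 ?addr0 // => c.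
  by rewrite eq_sym => /negbTE ->; rewrite mul0r.
rewrite mulr_sumr; apply: eq_bigr => c _.
rewrite -(bigA_distr_bigA (F c)) (bigD1 i) //= (bigD1 j) //=.
have -> : \sum_a F c i a = 1.
  rewrite /F eqxx (bigD1 c) //= eqxx big1 ?addr0 // => a /negbTE -> //.
have -> : \sum_a F c j a = \sum_b Phi c b.
  by apply: eq_bigr => a _; rewrite /F (negbTE ji) eqxx.
rewrite mul1r mulrC; congr (_ * _).
transitivity (\prod_(l | (l != i) && (l != j)) X%:R : R).
  apply: eq_bigr => l /andP[li lj]; rewrite /F (negbTE li) (negbTE lj).
  by rewrite sumr_const card_ord.
rewrite prodr_const; congr (_ ^+ _).
have -> : #|[pred l | (l != i) && (l != j)]| = #|[predC [:: i; j]]|.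
  by apply: eq_card => l; rewrite !inE negb_or.
have := cardC (mem [:: i; j]); rewrite card_ord (card_uniqP _) /=; last by rewrite inE ij.
by move=> /(congr1 (subn^~ 2)); rewrite addKn.
Qed.

(** * Tuples of primes *)

(** The sieve at level [Q = Y ^ k] bounds the count by [O(N / L)], where [L] is at least the [k]-th
    power of the harmonic sum over numbers built from sieving primes. Restoring the other primes in
    that sum costs the factor [H], and [Q ^ 6 <= N] absorbs the error. *)
Lemma card_prime_tuples_le (R : realFieldType) (k N X Y : nat) (y : 'I_k -> nat) :
  (0 < k)%N -> (0 < Y)%N -> (Y < X)%N -> (Y ^ (6 * k) <= N)%N ->
  (\sum_(0 <= t < N) [forall i, prime (N + t - y i)])%N%:R
    * (\sum_(1 <= n < Y.+1) n%:R^-1) ^+ k <=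
  (9 + 2 * k)%N%:R * N%:R *
    ((\prod_(2 <= p < 2 * k) (p%:R / (p%:R - 1))) *
     \prod_(ij : 'I_k * 'I_k | ij.1 != ij.2) pair_factor R X (y ij.1) (y ij.2)) ^+ k :> R.
Proof.
move=> k0 Y0 YX YN.
set Q := (Y ^ k)%N.
have Q0 : (0 < Q)%N by rewrite expn_gt0 Y0.
have YQ : (Y <= Q)%N by rewrite /Q -{1}(expn1 Y) leq_pexp2l.
have QN : (Q ^ 6 <= N)%N by rewrite /Q -expnM mulnC.
set P := [seq p <- index_iota 2 Q.+1 | sieving_prime y p].
have uP : uniq P by rewrite filter_uniq // iota_uniq.
have Psv : {in P, forall p, sieving_prime y p} by move=> p; rewrite mem_filter => /andP[].
set H := (_ * \prod_(ij | _) _ : R).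
set S := smooth_sum R (mem P) Y.
have S0 : 0 <= S by exact: smooth_sum_ge0.
have harm : \sum_(1 <= n < Y.+1) n%:R^-1 <= H * S.
  have -> : \sum_(1 <= n < Y.+1) n%:R^-1 =
      smooth_sum R (fun q => prime q && (q <= Y)%N) Y.
    rewrite /smooth_sum big_nat [RHS]big_nat_cond; apply: eq_bigl => n.
    case: (boolP (1 <= n < Y.+1)%N) => //= /andP[n1 nY].
    apply/esym/allP => q; rewrite mem_primes => /and3P[-> _ qn] /=.
    exact: leq_trans (dvdn_leq n1 qn) nY.
  set B := [seq p <- index_iota 2 Y.+1 | prime p && ~~ sieving_prime y p].
  apply: (le_trans (@smooth_sum_remove R (mem P) _ B Y _ _)).
  - by move=> p; rewrite mem_filter => /andP[/andP[]].
  - move=> q /andP[q_pr qY]; rewrite /= !mem_filter !mem_index_iota !ltnS q_pr qY.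
    rewrite prime_gt1 //= (leq_trans qY YQ) !andbT; exact: orNb.
  rewrite ler_wpM2r // big_filter; exact: nonsieving_prod_le.
set L := tprod P (sieve_g R k) Q.
have SL : S ^+ k <= L.
  apply: tprod_sieve_g_ge => // p /Psv /and3P[-> -> _] //.
set E := tprod P (fun p => p%:R : R) Q.
have E2 : E <= 2 * Q%:R ^+ 3.
  apply: le_trans (tprod_natr_le R P Q) _; rewrite mulrC ler_wpM2r ?exprn_ge0 //.
  by rewrite big_filter; have := prod_inv_sq_le R 1 Q.+1 (sieving_prime y); rewrite expr1.
have E0 : 0 <= E by apply: tprod_ge0.
have LE : L <= E.
  apply: le_tprod => p /Psv /and3P[p_pr kp _]; rewrite /sieve_g divr_ge0 //=.
  have p0 := prime_gt0 p_pr.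
  rewrite ler_pdivrMr ?ltr0n; last by lia.
  by rewrite -natrM ler_nat; nia.
have L0 : 0 <= L by apply: tprod_ge0 => p _; rewrite divr_ge0.
pose A t := [forall i, prime (N + t - y i)].
(* Sifting by [p] also discards the value [p] itself, so only values above [Q] are sifted; at most
   [k Q] of the [t] are lost. *)
pose A' t := A t && [forall i, (Q < N + t - y i)%N].
have sv : (\sum_(0 <= t < N) A' t)%N%:R * L <= N%:R + 2 * E ^+ 2.
  apply: (@sieve_upper_bound R k N Q (fun p t => [exists i, t + N == y i %[mod p]]) P A') => //.
    by move=> p /Psv; exact: sieving_prime_sifting.
  move=> t /andP[/forallP At /forallP A't] p; rewrite mem_filter mem_index_iota ltnS.
  case/and3P=> /and3P[p_pr _ _] _ pQ; apply/negP => /existsP[i].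
  have Ai := At i; have A'i := A't i.
  rewrite eqn_mod_dvd; last by lia.
  rewrite addnC dvdn_prime2 // => /eqP pE; lia.
have cnt : (\sum_(0 <= t < N) A t <= \sum_(0 <= t < N) A' t + k * Q)%N.
  apply: (@leq_trans (\sum_(0 <= t < N) (A' t + \sum_(i < k) (0 < N + t - y i <= Q)))%N).
    apply: leq_sum => t _; case At : (A t) => //.
    rewrite /A' At /=; case: (boolP [forall i, _]) => [//|].
    rewrite negb_forall => /existsP[i]; rewrite -leqNgt => le.
    rewrite add0n (bigD1 i) //= le andbT.
    by have /forallP/(_ i)/prime_gt0 -> := At.
  rewrite big_split /= leq_add2l exchange_big /=.
  apply: (@leq_trans (\sum_(i < k) Q)%N); last by rewrite sum_nat_const card_ord.
  by apply: leq_sum => i _; exact: sum_shifted_range_le.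
have QR : 1 <= Q%:R :> R by rewrite ler1n.
have Q6 : Q%:R ^+ 6 <= N%:R :> R by rewrite -natrX ler_nat.
(* Here [9 = 1 + 2 * 4] comes from [E ^ 2 <= 4 Q ^ 6 <= 4 N], and [2 k] from the lost [t], as
   [L <= E <= 2 Q ^ 3]. *)
have AL : (\sum_(0 <= t < N) A t)%N%:R * L <= (9 + 2 * k)%N%:R * N%:R.
  apply: (@le_trans _ _ ((\sum_(0 <= t < N) A' t)%N%:R * L + (k * Q)%N%:R * L)).
    by rewrite -mulrDl -natrD ler_wpM2r // ler_nat.
  have e1 : E ^+ 2 <= 4 * Q%:R ^+ 6.
    apply: le_trans (_ : (2 * Q%:R ^+ 3) ^+ 2 <= _).
      by rewrite lerXn2r ?nnegrE // (le_trans E0).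
    by apply: eq_ler; ring.
  have e2 : (k * Q)%N%:R * L <= 2 * k%:R * N%:R.
    have -> : 2 * k%:R * N%:R = k%:R * (2 * N%:R) :> R by ring.
    rewrite natrM -mulrA ler_wpM2l //.
    apply: le_trans (_ : Q%:R * (2 * Q%:R ^+ 3) <= _).
      by rewrite ler_wpM2l // (le_trans LE).
    rewrite mulrCA -exprS ler_wpM2l //; apply: le_trans Q6.
    by rewrite ler_weXn2l.
  apply: le_trans (lerD sv e2) _.
  rewrite natrD natrM; set n := N%:R in Q6 *; set z := Q%:R ^+ 6 in Q6 e1 *; lra.
(* A negative [H] would force [S = 0], although [H S] is at least a harmonic sum, hence at least
   [1]. *)
have H0 : 0 <= H.
  have [//|Hneg] := leP 0 H.
  have : 0 <= H * S.
    by apply: le_trans harm; apply: sumr_ge0 => n _; rewrite invr_ge0.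
  rewrite nmulr_rge0 // => S0'.
  have : 1 <= \sum_(1 <= n < Y.+1) n%:R^-1 :> R.
    rewrite big_ltn // invr1 lerDl; apply: sumr_ge0 => n _; by rewrite invr_ge0.
  move=> h1; have := le_trans h1 harm.
  have -> : S = 0 by apply/eqP; rewrite eq_le S0 S0'.
  by rewrite mulr0 ler10.
apply: (@le_trans _ _ ((\sum_(0 <= t < N) A t)%N%:R * (H ^+ k * L))).
  rewrite ler_wpM2l //; apply: le_trans (_ : (H * S) ^+ k <= _).
    rewrite lerXn2r ?nnegrE ?(mulr_ge0 H0 S0) //.
    by apply: sumr_ge0 => n _; rewrite invr_ge0.
  by rewrite exprMn ler_wpM2l // exprn_ge0.
by rewrite mulrCA mulrC ler_wpM2r // exprn_ge0.
Qed.

Lemma ln_le_harmonic (R : realType) (Y : nat) :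
  ln (Y.+1)%:R <= \sum_(1 <= n < Y.+1) n%:R^-1 :> R.
Proof.
elim: Y => [|Y IH]; first by rewrite big_geq // ln1.
rewrite big_nat_recr //=.
have -> : Y.+2%:R = Y.+1%:R * (1 + Y.+1%:R^-1) :> R.
  by rewrite mulrDr mulr1 divff ?pnatr_eq0 // natr1.
have pos : 0 < Y.+1%:R :> R by rewrite ltr0n.
have pos' : 0 < 1 + Y.+1%:R^-1 :> R by rewrite addr_gt0 ?invr_gt0.
by rewrite lnM ?posrE // lerD // le_ln1Dx // (lt_le_trans (ltrN10 _)) ?invr_ge0.
Qed.

(** [Y] is the integer part of the [m]-th root of [N], so [N < (Y + 1) ^ m]. *)
Lemma ln_le_harmonic_root (R : realType) (m N : nat) : (0 < m)%N -> (0 < N)%N ->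
  exists Y : nat, [/\ (0 < Y)%N, (Y ^ m <= N)%N &
    ln N%:R <= m%:R * \sum_(1 <= n < Y.+1) n%:R^-1 :> R].
Proof.
move=> m0 N0.
have ex : exists Y, (Y ^ m <= N)%N by exists 1%N; rewrite exp1n.
have ub Y : (Y ^ m <= N)%N -> (Y <= N)%N.
  by apply: leq_trans; case: Y => // Y; rewrite -{1}(expn1 Y.+1) leq_pexp2l.
case: (ex_maxnP ex ub) => Y YN Ymax; exists Y; split=> //.
  by apply: (Ymax 1%N); rewrite exp1n.
have lt : (N < Y.+1 ^ m)%N.
  by rewrite ltnNge; apply/negP => /Ymax; rewrite ltnn.
apply: le_trans (_ : ln ((Y.+1)%:R ^+ m) <= _).
  rewrite ler_ln ?posrE ?exprn_gt0 ?ltr0n // -natrX ler_nat; exact: ltnW.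
by rewrite lnXn ?ltr0n // -[_ *+ m]mulr_natl ler_wpM2l // ln_le_harmonic.
Qed.

(* Truncated subtraction is harmless: it returns [0], which is not prime. *)
Definition prime_weight (R : realType) (N t s : nat) : R :=
  if prime (N + t - s) && (N + t - s <= N)%N then ln (N + t - s)%:R else 0.

Lemma prime_weight_le (R : realType) (N t s : nat) :
  0 <= prime_weight R N t s <= ln N%:R * (prime (N + t - s))%:R.
Proof.
rewrite /prime_weight; case: ifP => [/andP[p_pr le]|_].
  have q0 := prime_gt0 p_pr; have N0 := leq_trans q0 le.
  by rewrite p_pr mulr1 ln_ge0 ?ler1n //= ler_ln ?posrE ?ltr0n ?ler_nat.
rewrite lexx mulr_ge0 //; case: N => [|N]; first by rewrite ln0.
by rewrite ln_ge0 // ler1n.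
Qed.

Definition tuple_weight (R : realType) (k N : nat) (y : 'I_k -> nat) : R :=
  \sum_(0 <= t < N) \prod_(i < k) prime_weight R N t (y i).

Lemma tuple_weight_ge0 (R : realType) (k N : nat) (y : 'I_k -> nat) :
  0 <= tuple_weight R N y.
Proof.
apply: sumr_ge0 => t _; apply: prodr_ge0 => i _.
by have /andP[] := prime_weight_le R N t (y i).
Qed.

Lemma tuple_weight_count (R : realType) (k N : nat) (y : 'I_k -> nat) :
  tuple_weight R N y <=
  ln N%:R ^+ k * (\sum_(0 <= t < N) [forall i, prime (N + t - y i)])%N%:R.
Proof.
rewrite /tuple_weight natr_sum mulr_sumr; apply: ler_sum => t _.
apply: (@le_trans _ _ (\prod_(i < k) (ln N%:R * (prime (N + t - y i))%:R))).
  by apply: ler_prod => i _; exact: prime_weight_le.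
rewrite big_split /= prodr_const card_ord.
have lnN : 0 <= ln N%:R :> R.
  by case: N => [|N]; [rewrite ln0|rewrite ln_ge0 // ler1n].
rewrite ler_wpM2l ?exprn_ge0 //.
case: (boolP [forall i, _]) => [/forallP h|]; first by rewrite big1 // => i _; rewrite h.
by rewrite negb_forall => /existsP[i /negbTE hi]; rewrite (bigD1 i) //= hi mul0r.
Qed.

Lemma tuple_weight_trivial (R : realType) (k N : nat) (y : 'I_k -> nat) : (0 < N)%N ->
  tuple_weight R N y <= ln N%:R ^+ k * N%:R.
Proof.
move=> N0; apply: le_trans (tuple_weight_count R N y) _.
rewrite ler_wpM2l ?exprn_ge0 ?ln_ge0 ?ler1n // ler_nat.
apply: (@leq_trans (\sum_(0 <= t < N) 1)%N); last by rewrite sum_nat_const_nat subn0 muln1.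
by apply: leq_sum => t _; case: [forall i, _].
Qed.

(** With [Y] near [N ^ (1 / (6 k))], the factor [(ln N) ^ k] is at most [(6 k) ^ k] times the power
    of the harmonic sum gained by the sieve. For tuples with a coincidence [tuple_weight_trivial] is
    used instead. *)
Lemma tuple_weight_le (R : realType) (k : nat) : (0 < k)%N ->
  exists2 C : R, 1 <= C & forall (N : nat) (y : 'I_k -> nat), (0 < N)%N ->
  tuple_weight R N y <= C * N%:R *
    (\prod_(ij : 'I_k * 'I_k | ij.1 != ij.2)
       pair_factor R (2 * N) (y ij.1) (y ij.2)) ^+ k.
Proof.
move=> k0; pose K : R := \prod_(2 <= p < 2 * k) (p%:R / (p%:R - 1)).
have K1 : 1 <= K.
  rewrite /K big_nat; apply: prodr_ge_one => p /andP[p2 _]; exact: prime_ratio_ge1.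
exists ((6 * k)%N%:R ^+ k * (9 + 2 * k)%N%:R * K ^+ k).
  by rewrite !mulr_ege1 ?exprn_ege1 ?ler1n //; lia.
move=> N y N0.
have m0 : (0 < 6 * k)%N by rewrite muln_gt0.
have [Y [Y0 YN lnN]] := ln_le_harmonic_root R m0 N0.
have YX : (Y < 2 * N)%N.
  have : (Y <= N)%N by apply: leq_trans YN; rewrite -{1}(expn1 Y) leq_pexp2l.
  lia.
have H := card_prime_tuples_le R y k0 Y0 YX YN.
apply: le_trans (tuple_weight_count R N y) _.
set T := \prod_(ij | _) _ in H *; set h := \sum_(1 <= n < Y.+1) _ in lnN H.
set c := (\sum_(0 <= t < N) _)%N%:R in H *.
have c0 : 0 <= c by exact: ler0n.
have ln0 : 0 <= ln N%:R :> R by rewrite ln_ge0 // ler1n.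
apply: (@le_trans _ _ (((6 * k)%N%:R * h) ^+ k * c)).
  by rewrite ler_wpM2r // lerXn2r ?nnegrE // (le_trans ln0).
rewrite exprMn [leLHS]mulrC mulrCA.
apply: le_trans (ler_wpM2l _ H) _; first by rewrite exprn_ge0.
rewrite -/K exprMn; apply: eq_ler; ring.
Qed.

(** Apply [ln u <= u - 1] to [u = N ^ (1 / m)], so that [1 + m ln u <= m u]. *)
Lemma pow_ln_le (R : realType) (m N : nat) : (0 < m)%N -> (0 < N)%N ->
  (1 + ln N%:R) ^+ m <= m%:R ^+ m * N%:R :> R.
Proof.
move=> m0 N0.
have N1 : 1 <= N%:R :> R by rewrite ler1n.
have NR : 0 < N%:R :> R by rewrite ltr0n.
have mR : 0 < m%:R :> R by rewrite ltr0n.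
have mR1 : 1 <= m%:R :> R by rewrite ler1n.
pose u : R := N%:R `^ m%:R^-1.
have u0 : 0 < u by rewrite powR_gt0.
have uN : u ^+ m = N%:R.
  by rewrite -powR_mulrn ?ltW // -powRrM mulVf ?gt_eqF // powRr1 // ltW.
have lnu : ln u <= u - 1.
  have e : u = 1 + (u - 1) by ring.
  by rewrite {1}e le_ln1Dx //; lra.
have lnN : ln N%:R = m%:R * ln u by rewrite -uN lnXn // mulr_natl.
rewrite -uN -exprMn lerXn2r ?nnegrE ?mulr_ge0 ?(ltW u0) // ?addr_ge0 ?ln_ge0 //.
  by rewrite exprn_ege1 // -(powRr0 N%:R) ler_powR // invr_ge0.
have := ler_wpM2l (ltW mR) lnu; rewrite uN lnN mulrBr mulr1; lra.
Qed.

(** The largest factor, raised to a power at least the number of factors, dominates the product and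
    is one of the summands. *)
Lemma prod_le_sum_pow (R : realFieldType) (I : finType) (P : pred I) (F : I -> R) (m : nat)
    (i0 : I) : P i0 -> (forall i, 1 <= F i) ->
  (\prod_(i | P i) F i) ^+ m <= \sum_(i | P i) F i ^+ (#|I| * m).
Proof.
move=> Pi0 F1; have F0 i : 0 <= F i by apply: le_trans (F1 i).
case: (Order.TotalTheory.arg_maxP F Pi0) => j Pj jmax.
apply: (@le_trans _ _ (F j ^+ (#|I| * m))); last first.
  rewrite (bigD1 j) //= lerDl; apply: sumr_ge0 => i _; exact: exprn_ge0.
rewrite exprM lerXn2r ?nnegrE ?prodr_ge0 ?exprn_ge0 //.
apply: (@le_trans _ _ (\prod_(i | P i) F j)).
  by apply: ler_prod => i Pi; rewrite F0; exact: jmax.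
by rewrite prodr_const ler_weXn2l // max_card.
Qed.

Lemma powR_le_pow (R : realType) (v z q : R) (M : nat) :
  0 <= v -> v <= z -> 1 <= z -> 0 <= q -> q <= M%:R -> v `^ q <= z ^+ M.
Proof.
move=> v0 vz z1 q0 qM; have z0 := le_trans v0 vz.
apply: (@le_trans _ _ (z `^ q)); first by rewrite ge0_ler_powR ?nnegrE.
by rewrite -powR_mulrn // ler_powR.
Qed.

(** Tuples with distinct entries are controlled by the moments of [h]. Those with [y i = y j] carry
    a power of [ln N], but they form only a fraction [1 / (2 N)] of all tuples for each pair, which
    outweighs it. *)
Lemma sum_tuple_weight_le (R : realType) (k : nat) (q : R) : (1 < k)%N -> 0 <= q ->
  exists2 C : R, 0 < C & forall N : nat, (0 < N)%N ->
  \sum_(y : {ffun 'I_k -> 'I_(2 * N)}) tuple_weight R N (fun i => y i) `^ q <=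
  C * N%:R `^ q * N%:R ^+ k.
Proof.
move=> k1 q0; have k0 : (0 < k)%N by apply: ltnW.
have [C0 C01 HC0] := tuple_weight_le R k0.
have C00 : 0 <= C0 by apply: le_trans C01.
set M := Num.bound q.
have qM : q <= M%:R by apply/ltW/archi_boundP.
have M0 : (0 < M)%N by rewrite -(ltr0n R); apply: le_lt_trans (archi_boundP q0).
(* The product of pair factors appears to the power [k M] once [q] is replaced by [M];
   [prod_le_sum_pow] multiplies this by the number of pairs. *)
set e := (#|{: 'I_k * 'I_k}| * (k * M))%N.
set D : R := (k * M)%N%:R ^+ (k * M) + C0 ^+ M * (2 * 2 ^+ (2 ^ e.+1)).
have D0 : 0 < D.
  rewrite /D ltr_wpDr ?exprn_gt0 ?ltr0n ?muln_gt0 ?k0 //.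
  by rewrite mulr_ge0 ?exprn_ge0 // mulr_ge0 ?exprn_ge0.
exists (k%:R * k%:R * D * 2 ^+ k).
  by rewrite !mulr_gt0 ?ltr0n ?exprn_gt0.
move=> N N0; set X := (2 * N)%N.
have lnN : 0 <= ln N%:R :> R by rewrite ln_ge0 // ler1n.
have NR : 0 < N%:R :> R by rewrite ltr0n.
(* One function of two entries serves both cases: its diagonal pays for coincidences, the rest for
   distinct entries. *)
pose Phi (a b : 'I_X) : R :=
  if a == b then (1 + ln N%:R) ^+ (k * M)
  else C0 ^+ M * pair_factor R X a b ^+ e.
have Phi0 a b : 0 <= Phi a b.
  rewrite /Phi; case: ifP => _; first by rewrite exprn_ge0 // addr_ge0.
  by rewrite mulr_ge0 ?exprn_ge0 // (le_trans ler01) // pair_factor_ge1.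
have pointwise (y : {ffun 'I_k -> 'I_X}) : tuple_weight R N (fun i => y i) `^ q <=
    N%:R `^ q * \sum_(ij : 'I_k * 'I_k | ij.1 != ij.2) Phi (y ij.1) (y ij.2).
  set W := tuple_weight _ _ _; have W0 : 0 <= W by exact: tuple_weight_ge0.
  pose v := W / N%:R; have v0 : 0 <= v by rewrite divr_ge0.
  have -> : W = N%:R * v by rewrite /v mulrCA divff ?mulr1 ?gt_eqF.
  rewrite powRM ?(ltW NR) // ler_wpM2l ?powR_ge0 //.
  have [/injectiveP yinj|] := boolP (injectiveb y).
    set T := \prod_(ij : 'I_k * 'I_k | ij.1 != ij.2) pair_factor R X (y ij.1) (y ij.2).
    have T1 : 1 <= T by apply: prodr_ge_one => ij _; exact: pair_factor_ge1.
    have vle : v <= C0 * T ^+ k.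
      by rewrite ler_pdivrMr // mulrAC; exact: HC0.
    apply: le_trans (powR_le_pow v0 vle _ q0 qM) _.
      by rewrite mulr_ege1 ?exprn_ege1.
    rewrite exprMn -exprM.
    apply: (@le_trans _ _ (\sum_(ij : 'I_k * 'I_k | ij.1 != ij.2)
        C0 ^+ M * pair_factor R X (y ij.1) (y ij.2) ^+ e)); last first.
      apply: ler_sum => ij nij; rewrite /Phi; case: eqP => [/yinj eij|//].
      by rewrite eij eqxx in nij.
    rewrite -mulr_sumr ler_wpM2l ?exprn_ge0 //.
    apply: (@prod_le_sum_pow _ _ _ _ _ (Ordinal k0, Ordinal k1)) => //.
    by move=> ij; exact: pair_factor_ge1.
  case/injectivePn => i [j ij yij].
  have vle : v <= (1 + ln N%:R) ^+ k.
    rewrite ler_pdivrMr //; apply: le_trans (tuple_weight_trivial R _ N0) _.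
    by rewrite ler_wpM2r ?(ltW NR) // lerXn2r ?nnegrE ?addr_ge0 // lerDr.
  apply: le_trans (powR_le_pow v0 vle _ q0 qM) _.
    by rewrite exprn_ege1 // lerDl.
  rewrite (bigD1 (i, j)) //= -exprM {1}/Phi yij eqxx lerDl.
  by apply: sumr_ge0 => ij' _.
apply: le_trans (ler_sum _ (fun y _ => pointwise y)) _.
rewrite -mulr_sumr exchange_big /=.
have sumPhi : \sum_a \sum_b Phi a b <= D * X%:R ^+ 2.
  have inner a : \sum_b Phi a b <= D * X%:R.
    rewrite (bigD1 a) //= {1}/Phi eqxx /D mulrDl; apply: lerD.
      apply: le_trans (pow_ln_le R _ N0) _; first by rewrite muln_gt0 k0.
      by rewrite ler_wpM2l ?exprn_ge0 // ler_nat /X leq_pmull.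
    rewrite -mulrA.
    have -> : 2 * 2 ^+ (2 ^ e.+1) * X%:R = 2 * X%:R * 2 ^+ (2 ^ e.+1) :> R by ring.
    apply: le_trans (ler_wpM2l _ (sum_pair_factor_le R e X (ltn_ord a))); last exact: exprn_ge0.
    rewrite mulr_sumr; apply: eq_ler; apply: eq_big => b //.
    by rewrite /Phi eq_sym => /negbTE ->.
  apply: le_trans (ler_sum _ (fun a _ => inner a)) _.
  by rewrite sumr_const card_ord -[_ *+ X]mulr_natl mulrCA -expr2.
apply: (@le_trans _ _ (N%:R `^ q * \sum_(ij : 'I_k * 'I_k) X%:R ^+ (k - 2) * (D * X%:R ^+ 2))).
  rewrite ler_wpM2l ?powR_ge0 // big_mkcond /=; apply: ler_sum => -[i j] _ /=.
  case: ifP => [ij|_]; last by rewrite !mulr_ge0 ?exprn_ge0 // ltW.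
  by rewrite (sum_ffun_pair Phi ij) ler_wpM2l // exprn_ge0.
rewrite sumr_const card_prod card_ord -[_ *+ (k * k)]mulr_natl natrM.
have -> : X%:R ^+ (k - 2) * (D * X%:R ^+ 2) = D * (2 ^+ k * N%:R ^+ k).
  by rewrite mulrCA -exprD subnK // /X natrM exprMn.
apply: eq_ler; ring.
Qed.

(** * From tuples to the block estimate *)

Lemma powR_powRV (R : realType) (x p : R) : 0 <= x -> p != 0 -> (x `^ p^-1) `^ p = x.
Proof. by move=> x0 p0; rewrite -powRrM mulVf // powRr1. Qed.

(** Young's inequality applied termwise after dividing by the two norms, once both are nonzero. *)
Lemma hoelder_sum (R : realType) (I : finType) (a b : I -> R) (p q : R) :
  0 < p -> 0 < q -> p^-1 + q^-1 = 1 -> (forall i, 0 <= a i) -> (forall i, 0 <= b i) ->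
  \sum_i a i * b i <= (\sum_i a i `^ p) `^ p^-1 * (\sum_i b i `^ q) `^ q^-1.
Proof.
move=> p0 q0 pq a0 b0.
set A := \sum_i a i `^ p; set B := \sum_i b i `^ q.
have null (c : I -> R) r : \sum_i c i `^ r = 0 -> forall i, c i = 0.
  move=> S0 i; apply: (@powR_eq0_eq0 _ _ r); apply/eqP; rewrite eq_le powR_ge0 andbT -S0.
  by rewrite (bigD1 i) //= lerDl sumr_ge0 // => j _; exact: powR_ge0.
have A0 : 0 <= A by apply: sumr_ge0 => i _; exact: powR_ge0.
have B0 : 0 <= B by apply: sumr_ge0 => i _; exact: powR_ge0.
have RHS0 : 0 <= A `^ p^-1 * B `^ q^-1 by rewrite mulr_ge0 ?powR_ge0.
have [/null az|Anz] := eqVneq A 0; first by rewrite big1 // => i _; rewrite az mul0r.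
have [/null bz|Bnz] := eqVneq B 0; first by rewrite big1 // => i _; rewrite bz mulr0.
have Agt : 0 < A by rewrite lt0r Anz.
have Bgt : 0 < B by rewrite lt0r Bnz.
have al0 : 0 < A `^ p^-1 by exact: powR_gt0.
have be0 : 0 < B `^ q^-1 by exact: powR_gt0.
have alp : (A `^ p^-1) `^ p = A by rewrite powR_powRV ?gt_eqF.
have beq : (B `^ q^-1) `^ q = B by rewrite powR_powRV ?gt_eqF.
clear RHS0; move: (A `^ p^-1) (B `^ q^-1) al0 be0 alp beq => al be al0 be0 alp beq.
have term i : a i * b i <= al * be * (a i `^ p / (A * p) + b i `^ q / (B * q)).
  have xa : a i = al * (a i / al) by rewrite mulrCA divff ?mulr1 ?gt_eqF.
  have xb : b i = be * (b i / be) by rewrite mulrCA divff ?mulr1 ?gt_eqF.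
  have x0 : 0 <= a i / al by rewrite divr_ge0 // ltW.
  have y0 : 0 <= b i / be by rewrite divr_ge0 // ltW.
  have := conjugate_powR x0 y0 p0 q0 pq.
  have -> : a i `^ p / (A * p) = (a i / al) `^ p / p.
    rewrite {1}xa powRM ?(ltW al0) // alp; field; by rewrite !gt_eqF.
  have -> : b i `^ q / (B * q) = (b i / be) `^ q / q.
    rewrite {1}xb powRM ?(ltW be0) // beq; field; by rewrite !gt_eqF.
  move=> h; rewrite {1}xa {1}xb mulrACA ler_wpM2l // mulr_ge0 // ltW //.
apply: le_trans (ler_sum _ (fun i _ => term i)) _.
rewrite -mulr_sumr big_split /= -!mulr_suml -/A -/B.
have -> : A / (A * p) + B / (B * q) = p^-1 + q^-1 by field; rewrite !gt_eqF.
by rewrite pq mulr1.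
Qed.

Lemma powR_prod (R : realType) (I : finType) (x : I -> R) (p : R) : (forall i, 0 <= x i) ->
  (\prod_i x i) `^ p = \prod_i x i `^ p.
Proof.
move=> x0; suff [] : 0 <= \prod_i x i /\ (\prod_i x i) `^ p = \prod_i x i `^ p by [].
apply: (big_rec2 (fun y z => 0 <= y /\ y `^ p = z)) => [|i y z _ [y0 <-]].
  by rewrite powR1.
by split; rewrite ?mulr_ge0 // powRM.
Qed.

(** Hölder against the constant [1] with exponents [k / q] and [(1 - q / k) ^ (-1)]. *)
Lemma sum_powR_le_pow (R : realType) (N k : nat) (q : R) (S : 'I_N -> R) :
  0 < q -> q < k%:R -> (forall t, 0 <= S t) ->
  \sum_t S t `^ q <= N%:R `^ (1 - q / k%:R) * (\sum_t S t ^+ k) `^ (q / k%:R).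
Proof.
move=> q0 qk S0; have kR : 0 < k%:R :> R by apply: lt_trans qk.
have r0 : 0 < k%:R / q by rewrite divr_gt0.
have lt1 : q / k%:R < 1 by rewrite ltr_pdivrMr // mul1r.
have s0 : 0 < (1 - q / k%:R)^-1 by rewrite invr_gt0 subr_gt0.
have rs : (k%:R / q)^-1 + ((1 - q / k%:R)^-1)^-1 = 1.
  by rewrite invrK invf_div addrC subrK.
have := hoelder_sum r0 s0 rs (fun t => powR_ge0 (S t) q) (fun=> ler01).
under eq_bigr do rewrite mulr1; move=> /le_trans; apply.
rewrite invrK invf_div powR1 sumr_const card_ord mulrC ler_wpM2l ?powR_ge0 //.
apply: eq_ler; congr (_ `^ _); apply: eq_bigr => t _.
by rewrite -powRrM mulrCA divff ?gt_eqF // mulr1 powR_mulrn.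
Qed.

(** Expand the [k]-th power over tuples and apply Hölder there: the part with [f] factors into
    [(sum f ^ p) ^ k], the other is the moment of [tuple_weight]. *)
Lemma sum_pow_window_le (R : realType) (p q : R) (k : nat) : 0 < p -> 0 < q ->
  p^-1 + q^-1 = 1 -> (1 < k)%N ->
  exists2 C : R, 0 < C & forall (N : nat) (f : nat -> R), (0 < N)%N -> (forall s, 0 <= f s) ->
  \sum_(t < N) (\sum_(s < 2 * N) f s * prime_weight R N t s) ^+ k <=
  ((\sum_(s < 2 * N) f s `^ p) ^+ k) `^ p^-1 * (C * N%:R `^ q * N%:R ^+ k) `^ q^-1.
Proof.
move=> p0 q0 pq k1.
have [C C0 HC] := sum_tuple_weight_le k1 (ltW q0).
exists C => // N f N0 f0.
have w0 t s : 0 <= prime_weight R N t s by have /andP[] := prime_weight_le R N t s.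
have expand (t : 'I_N) : (\sum_(s < 2 * N) f s * prime_weight R N t s) ^+ k =
    \sum_(y : {ffun 'I_k -> 'I_(2 * N)}) (\prod_i f (y i)) *
      \prod_i prime_weight R N t (y i).
  rewrite -[in LHS](card_ord k) -prodr_const bigA_distr_bigA /=.
  by apply: eq_bigr => y _; rewrite big_split.
under eq_bigr do rewrite expand.
rewrite exchange_big /=.
under eq_bigr do rewrite -mulr_sumr.
have Fy0 (y : {ffun 'I_k -> 'I_(2 * N)}) : 0 <= \prod_i f (y i) by apply: prodr_ge0.
have Wy0 (y : {ffun 'I_k -> 'I_(2 * N)}) :
    0 <= \sum_(t < N) \prod_i prime_weight R N t (y i).
  by apply: sumr_ge0 => t _; apply: prodr_ge0.
apply: le_trans (hoelder_sum p0 q0 pq Fy0 Wy0) _.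
have -> : \sum_(y : {ffun 'I_k -> 'I_(2 * N)}) (\prod_i f (y i)) `^ p =
    (\sum_(s < 2 * N) f s `^ p) ^+ k.
  rewrite -[in RHS](card_ord k) -prodr_const bigA_distr_bigA /=.
  by apply: eq_bigr => y _; rewrite powR_prod.
rewrite ler_wpM2l ?powR_ge0 // ge0_ler_powR ?nnegrE ?invr_ge0 ?(ltW q0) //.
- by apply: sumr_ge0 => y _; exact: powR_ge0.
- by rewrite !mulr_ge0 ?powR_ge0 ?exprn_ge0 // ltW.
apply: le_trans (HC N N0); apply: eq_ler.
by apply: eq_bigr => y _; rewrite /tuple_weight big_mkord.
Qed.

(** The powers of [N] combine as [N ^ (1 - q / k) (N ^ q N ^ k) ^ (1 / k) = N ^ 2], independently of
    [k]. *)
Lemma sum_powR_window_le (R : realType) (p q : R) : 0 < p -> 0 < q -> p^-1 + q^-1 = 1 ->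
  exists2 C : R, 0 < C & forall (N : nat) (f : nat -> R), (0 < N)%N -> (forall s, 0 <= f s) ->
  \sum_(t < N) (\sum_(s < 2 * N) f s * prime_weight R N t s) `^ q <=
  C * N%:R ^+ 2 * (\sum_(s < 2 * N) f s `^ p) `^ (q / p).
Proof.
move=> p0 q0 pq.
(* Beyond [k > q], the moment estimate needs [k >= 2], so that a pair of indices exists. *)
set k := (Num.bound q).+2.
have qk : q < k%:R.
  by apply: lt_le_trans (archi_boundP (ltW q0)) _; rewrite ler_nat /k; lia.
have kR : 0 < k%:R :> R by rewrite ltr0n.
have [C C0 HC] := sum_pow_window_le p0 q0 pq (isT : (1 < k)%N).
exists (C `^ k%:R^-1); first exact: powR_gt0.
move=> N f N0 f0; have NR : 0 < N%:R :> R by rewrite ltr0n.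
have S0 (t : 'I_N) : 0 <= \sum_(s < 2 * N) f s * prime_weight R N t s.
  apply: sumr_ge0 => s _; rewrite mulr_ge0 //.
  by have /andP[] := prime_weight_le R N t s.
apply: le_trans (sum_powR_le_pow q0 qk S0) _.
set A := \sum_(s < 2 * N) f s `^ p.
have A0 : 0 <= A by apply: sumr_ge0 => s _; exact: powR_ge0.
have qk0 : 0 < q / k%:R by rewrite divr_gt0.
apply: (@le_trans _ _ (N%:R `^ (1 - q / k%:R) *
   (((A ^+ k) `^ p^-1 * (C * N%:R `^ q * N%:R ^+ k) `^ q^-1) `^ (q / k%:R)))).
  rewrite ler_wpM2l ?powR_ge0 // ge0_ler_powR ?nnegrE ?(ltW qk0) ?mulr_ge0 ?powR_ge0 ?HC //.
  by apply: sumr_ge0 => t _; exact: exprn_ge0.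
rewrite powRM ?powR_ge0 // -!powRrM -(powR_mulrn _ A0) -powRrM.
have -> : k%:R * (p^-1 * (q / k%:R)) = q / p by field; rewrite !gt_eqF.
have -> : q^-1 * (q / k%:R) = k%:R^-1 by field; rewrite !gt_eqF.
rewrite powRM ?exprn_ge0 ?mulr_ge0 ?powR_ge0 ?(ltW C0) //.
rewrite powRM ?powR_ge0 ?(ltW C0) // -powRrM -/(q / k%:R).
have -> : (N%:R ^+ k) `^ k%:R^-1 = N%:R :> R.
  by rewrite -powR_mulrn ?(ltW NR) // -powRrM divff ?gt_eqF // powRr1 // ltW.
have -> : N%:R `^ (1 - q / k%:R) = N%:R / N%:R `^ (q / k%:R) :> R.
  by rewrite powRB ?powRr1 ?(ltW NR) // (gt_eqF NR) implybT.
apply: eq_ler; field.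
by rewrite gt_eqF // powR_gt0.
Qed.

(** Substitute [s = N + t - q], which lies in [[t, t + N]]; elsewhere in the window the weight
    vanishes. *)
Lemma prime_sum_window (R : realType) (N t : nat) (g : nat -> R) : (t < N)%N ->
  \sum_(q < N.+1 | prime q) g (N + t - q)%N * ln (q : nat)%:R =
  \sum_(s < 2 * N) g s * prime_weight R N t s.
Proof.
move=> tN.
rewrite -(big_mkord prime (fun q => g (N + t - q)%N * ln q%:R)).
rewrite -(big_mkord xpredT (fun s => g s * prime_weight R N t s)).
have zero (s : nat) : ~~ (t <= s < t + N.+1)%N -> prime_weight R N t s = 0.
  move=> h; rewrite /prime_weight; case: ifP => // /andP[/prime_gt0 p0 le].
  by move: h; rewrite negb_and; lia.
rewrite [RHS](big_cat_nat (n := t)) //=; last by lia.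
rewrite [in RHS](big_cat_nat (n := (t + N.+1)%N) (m := t)) ?leq_addr //=; last by lia.
rewrite [X in _ = X + _]big_nat_cond [X in _ = X + _]big1 ?add0r; last first.
  by move=> s /andP[/andP[_ st] _]; rewrite zero ?mulr0 //; lia.
rewrite [X in _ = _ + X]big_nat_cond [X in _ = _ + X]big1 ?addr0; last first.
  by move=> s /andP[/andP[st _] _]; rewrite zero ?mulr0 //; lia.
rewrite -{2}[t]add0n big_addn addKn big_nat_rev /= add0n big_mkcond /=.
rewrite big_nat [RHS]big_nat; apply: eq_bigr => s /andP[_ sN].
rewrite subSS /prime_weight.
have -> : (N + t - (s + t) = N - s)%N by lia.
have -> : (N + t - (N - s) = s + t)%N by lia.
rewrite leq_subr andbT; case: ifP => // _; by rewrite mulr0.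
Qed.

(** With [A] the full sum, [a ^ r = a a ^ (r - 1) <= a A ^ (r - 1)]. *)
Lemma sum_powR_le_powR_sum (R : realType) (M : nat) (a : nat -> R) (r : R) : 1 <= r ->
  (forall m, 0 <= a m) ->
  \sum_(0 <= m < M) a m `^ r <= (\sum_(0 <= m < M) a m) `^ r.
Proof.
move=> r1 a0; set A := \sum_(0 <= m < M) a m.
have A0 : 0 <= A by apply: sumr_ge0.
have r0 : 0 < r by apply: lt_le_trans r1.
rewrite -(mulr_powRB1 A0 r0) mulr_suml big_nat [leRHS]big_nat.
apply: ler_sum => m /andP[_ mM]; rewrite -(mulr_powRB1 (a0 m) r0) ler_wpM2l //.
rewrite ge0_ler_powR ?nnegrE ?subr_ge0 // /A big_mkord.
by rewrite (bigD1 (Ordinal mM)) //= lerDl sumr_ge0.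
Qed.

(** A block of outputs depends on two consecutive blocks of [f] only. As [q / p >= 1], the block
    estimates add up, and each block of [f] is used at most twice, whence [2 ^ (q / p)]. *)
Lemma sum_powR_prime_sum_le (R : realType) (p q : R) : 0 < p -> p <= q -> p^-1 + q^-1 = 1 ->
  exists2 C : R, 0 < C & forall (N M : nat) (f : nat -> R), (0 < N)%N -> (forall s, 0 <= f s) ->
  \sum_(0 <= j < N * M) (\sum_(l < N.+1 | prime l) f (N + j - l)%N * ln (l : nat)%:R) `^ q <=
  C * N%:R ^+ 2 * (\sum_(0 <= j < N * M.+1) f j `^ p) `^ (q / p).
Proof.
move=> p0 pq pq1; have q0 : 0 < q by apply: lt_le_trans pq.
have [C C0 HC] := sum_powR_window_le p0 q0 pq1.
have r1 : 1 <= q / p by rewrite ler_pdivlMr // mul1r.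
exists (C * 2 `^ (q / p)); first by rewrite mulr_gt0 // powR_gt0.
move=> N M f N0 f0.
pose b m : R := \sum_(0 <= i < N) f (i + N * m)%N `^ p.
have b0 m : 0 <= b m by apply: sumr_ge0 => i _; exact: powR_ge0.
rewrite !big_nat_blocks -/b.
apply: (@le_trans _ _ (\sum_(0 <= m < M) C * N%:R ^+ 2 * (b m + b m.+1) `^ (q / p))).
  apply: ler_sum => m _.
  apply: le_trans (_ : C * N%:R ^+ 2 * (\sum_(s < 2 * N) f (s + N * m)%N `^ p) `^ (q / p) <= _).
    apply: le_trans (HC N (fun s => f (s + N * m)%N) N0 (fun s => f0 _)).
    rewrite big_mkord; apply: ler_sum => t _.
    rewrite -(prime_sum_window (fun s => f (s + N * m)%N) (ltn_ord t)).
    apply: eq_ler; congr (_ `^ _); apply: eq_bigr => l _.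
    have -> : (N + (t + N * m) - l = N + t - l + N * m)%N by have := ltn_ord l; lia.
    by [].
  rewrite -(big_mkord xpredT (fun s => f (s + N * m)%N `^ p)).
  suff -> : \sum_(0 <= s < 2 * N) f (s + N * m)%N `^ p = b m + b m.+1 by [].
  rewrite (big_cat_nat (n := N)) ?leq_pmull //=; congr (_ + _).
  rewrite -{1}[N]add0n big_addn (_ : (2 * N - N)%N = N); last by lia.
  by apply: eq_bigr => i _; rewrite -addnA mulnS.
rewrite -mulr_sumr [C * _ * _ in leRHS]mulrAC -[leRHS]mulrA.
rewrite ler_wpM2l ?mulr_ge0 ?exprn_ge0 ?(ltW C0) //.
apply: le_trans (sum_powR_le_powR_sum M r1 (fun m => addr_ge0 (b0 m) (b0 m.+1))) _.
have B0 : 0 <= \sum_(0 <= m < M.+1) b m by apply: sumr_ge0.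
rewrite -powRM // ge0_ler_powR ?nnegrE ?divr_ge0 ?mulr_ge0 ?(ltW p0) ?(ltW q0) //.
  by apply: sumr_ge0 => m _; rewrite addr_ge0.
rewrite big_split /= mulr_natl mulr2n lerD //.
  by rewrite [leRHS]big_nat_recr //= lerDl b0.
by rewrite [leRHS]big_nat_recl //= lerDr b0.
Qed.

(** * Summation over the integers *)

Lemma sum_le_esum (R : realType) (T : choiceType) (g : T -> R) (e : nat -> T) (n : nat) :
  injective e -> ((\sum_(0 <= j < n) g (e j))%:E <= \esum_(x in [set: T]) (g x)%:E)%E.
Proof.
move=> einj; apply: esum_ge; exists (e @` `I_n).
  by split; [exact/finite_image/finite_II|].
rewrite fsbig_image; last by move=> i j _ _; exact: einj.
by rewrite -(fsbig_ord _ _ (fun j => (g (e j))%:E)) sumEFin big_mkord.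
Qed.

(** Every finite set of integers lies in a window of [2 m + 1] whole blocks starting at [- N m]. *)
Lemma esum_int_le (R : realType) (g : int -> R) (N : nat) (B : \bar R) :
  (forall x, 0 <= g x) -> (0 < N)%N ->
  (forall m : nat, ((\sum_(0 <= j < N * (2 * m).+1) g (j%:Z - (N * m)%N%:Z))%:E <= B)%E) ->
  (\esum_(x in [set: int]) (g x)%:E <= B)%E.
Proof.
move=> g0 N0 H; apply: ge_ereal_sup => _ [X [finX _] <-].
have [s Xs] : exists s : seq int, X = [set` s] by exact/finite_seqP.
pose m := (\sum_(x <- s) `|x|)%N.
have bnd x : X x -> (`|x| <= m)%N.
  by rewrite Xs /= => xs; rewrite /m (big_rem x) //= leq_addr.
apply: le_trans (H m); set n := (N * _)%N.
pose e j := j%:Z - (N * m)%N%:Z : int.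
have einj : injective e by move=> i j; rewrite /e; lia.
rewrite -sumEFin big_mkord (fsbig_ord _ _ (fun j => (g (e j))%:E)).
have <- : (\sum_(x \in e @` `I_n) (g x)%:E = \sum_(j \in `I_n) (g (e j))%:E)%E.
  by rewrite fsbig_image // => i j _ _; exact: einj.
apply: lee_fsum_nneg_subset => //.
- exact/finite_image/finite_II.
- move=> x; rewrite !inE => Xx; have := bnd x Xx => xm.
  have xNm : (`|x| <= N * m)%N by apply: (leq_trans xm); rewrite leq_pmull.
  exists (absz ((x : int) + (N * m)%N%:Z)) => /=; last by rewrite /e; lia.
  rewrite /n; have : (N * (2 * m).+1 = N * m + N * m + N)%N by ring.
  by lia.
- by move=> x _; rewrite lee_fin.
Qed.

Lemma avgA_norm_le (R : realType) (N K j : nat) (f : int -> R) :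
  `|avgA N f ((N + j)%N%:Z - K%:Z)| <=
  N%:R^-1 * \sum_(l < N.+1 | prime l) `|f ((N + j - l)%N%:Z - K%:Z)| * ln (l : nat)%:R.
Proof.
rewrite /avgA normrM ger0_norm ?invr_ge0 // ler_wpM2l ?invr_ge0 //.
apply: le_trans (ler_norm_sum _ _ _) _; apply: ler_sum => l l_pr.
rewrite normrM [`|ln _|]ger0_norm ?ln_ge0 ?ler1n ?prime_gt0 //.
have -> : ((N + j)%N%:Z - K%:Z - (l : nat)%:Z = (N + j - l)%N%:Z - K%:Z)%R.
  by have := ltn_ord l; lia.
by [].
Qed.

Lemma esum_avgA_le (R : realType) (p q : R) : 0 < p -> p <= q -> p^-1 + q^-1 = 1 ->
  exists2 C : R, 0 < C & forall (N : nat) (f : int -> R) (B : R), (0 < N)%N ->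
  \esum_(x in [set: int]) (`|f x| `^ p)%:E = B%:E ->
  (\esum_(x in [set: int]) (`|avgA N f x| `^ q)%:E <=
   (C * N%:R `^ (2 - q) * B `^ (q / p))%:E)%E.
Proof.
move=> p0 pq pq1; have q0 : 0 < q by apply: lt_le_trans pq.
have [C C0 HC] := sum_powR_prime_sum_le p0 pq pq1.
exists C => // N f B N0 fB; have NR : 0 < N%:R :> R by rewrite ltr0n.
apply: (@esum_int_le _ (fun x => `|avgA N f x| `^ q) N) => // m.
(* The window of [f] starts at [- K], one block before that of the averages, which look back by at
   most [N]. *)
set M := (2 * m).+1; set K := (N * m.+1)%N.
pose f0 j := `|f (j%:Z - K%:Z)|.
have f0B : \sum_(0 <= j < N * M.+1) f0 j `^ p <= B.
  rewrite -lee_fin -fB.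
  apply: (@sum_le_esum _ _ (fun x => `|f x| `^ p) (fun j => j%:Z - K%:Z)).
  by move=> i j; lia.
rewrite lee_fin.
apply: (@le_trans _ _ (\sum_(0 <= j < N * M) (N%:R^-1 `^ q *
   (\sum_(l < N.+1 | prime l) f0 (N + j - l)%N * ln (l : nat)%:R) `^ q))).
  apply: ler_sum => j _.
  have S0 : 0 <= \sum_(l < N.+1 | prime l) f0 (N + j - l)%N * ln (l : nat)%:R.
    by apply: sumr_ge0 => l l_pr; rewrite /f0 mulr_ge0 ?normr_ge0 ?ln_ge0 ?ler1n ?prime_gt0.
  rewrite -powRM ?invr_ge0 // ge0_ler_powR ?nnegrE ?(ltW q0) ?mulr_ge0 ?invr_ge0 //.
  have -> : j%:Z - (N * m)%N%:Z = (N + j)%N%:Z - K%:Z by rewrite /K mulnS; lia.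
  exact: avgA_norm_le.
rewrite -mulr_sumr.
apply: le_trans (ler_wpM2l (powR_ge0 _ _) (HC N M f0 N0 (fun=> normr_ge0 _))) _.
have -> : N%:R `^ (2 - q) = N%:R^-1 `^ q * N%:R ^+ 2 :> R.
  rewrite powRB ?(gt_eqF NR) ?implybT // powR_mulrn ?(ltW NR) // mulrC; congr (_ * _).
  by rewrite -[N%:R^-1]powR_inv1 ?(ltW NR) // -powRrM mulN1r powRN.
rewrite [C * (_ * _)]mulrCA -[leRHS]mulrA ler_wpM2l ?powR_ge0 //.
rewrite ler_wpM2l ?mulr_ge0 ?exprn_ge0 ?(ltW C0) // ge0_ler_powR ?nnegrE ?divr_ge0 ?(ltW p0) ?(ltW q0) //.
- by apply: sumr_ge0 => j _; exact: powR_ge0.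
- by apply: le_trans f0B; apply: sumr_ge0 => j _; exact: powR_ge0.
Qed.

Theorem theorem4 (R : realType) (p : R) (hp1 : 1 < p) (hp2 : p <= 2) :
  exists C : R, 0 < C /\
    forall (N : nat) (f : int -> R),
      (lpnorm (conj_exp p) (avgA N f)
        <= (C * N%:R `^ ((conj_exp p)^-1 - p^-1))%:E * lpnorm p f)%E.
Proof.
have p0 : 0 < p by apply: lt_trans hp1.
have p1 : 0 < p - 1 by rewrite subr_gt0.
set q := conj_exp p.
have q0 : 0 < q by rewrite divr_gt0.
(* This is where [p <= 2] enters: [p <= p / (p - 1)] means [p - 1 <= 1]. *)
have pq : p <= q by rewrite /q /conj_exp ler_pdivlMr // ler_piMr ?(ltW p0) //; lra.
have pq1 : p^-1 + q^-1 = 1 by rewrite /q /conj_exp; field; rewrite !gt_eqF.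
have [C C0 HC] := esum_avgA_le p0 pq pq1.
exists (C `^ q^-1); split=> [|N f]; first exact: powR_gt0.
(* For [N = 0] the convention [0^-1 = 0] makes the average vanish. *)
have [->|N0] := posnP N.
  rewrite {1}/lpnorm esum1 ?poweR0r ?mule_ge0 ?invr_eq0 ?gt_eqF ?poweR_ge0 //.
    by rewrite lee_fin mulr_ge0 ?powR_ge0.
  by move=> x _; rewrite /avgA invr0 mul0r normr0 powR0 ?gt_eqF.
have NR : 0 < N%:R :> R by rewrite ltr0n.
set S := \esum_(x in [set: int]) (`|f x| `^ p)%:E.
have S0 : (0 <= S)%E by apply: esum_ge0 => x _; rewrite lee_fin powR_ge0.
rewrite /lpnorm -/S.
(* If [f] is not [p]-summable, the right side is [+oo], its constant being positive. *)
have [fB|Sy] := boolP (S \is a fin_num); last first.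
  have -> : S = +oo%E by move: Sy S0; case: S => [r| |].
  rewrite poweRyr ?invr_eq0 ?gt_eqF // gt0_muley ?leey // lte_fin.
  by rewrite mulr_gt0 ?powR_gt0.
move: fB => /fineK SE; move: (fine S) SE => B /esym SE.
have B0 : 0 <= B by rewrite -lee_fin -SE.
have := HC N f B N0 SE.
rewrite SE poweR_EFin -EFinM => H.
apply: (@le_trans _ _ (poweR (C * N%:R `^ (2 - q) * B `^ (q / p))%:E q^-1)).
  apply: gt0_ler_poweR => //; rewrite ?invr_ge0 ?(ltW q0) // in_itv /= leey andbT.
    by apply: esum_ge0 => x _; rewrite lee_fin powR_ge0.
  by rewrite lee_fin !mulr_ge0 ?powR_ge0 ?(ltW C0).
rewrite poweR_EFin lee_fin powRM ?mulr_ge0 ?powR_ge0 ?(ltW C0) //.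
rewrite powRM ?powR_ge0 ?(ltW C0) // -!powRrM.
have -> : q / p * q^-1 = p^-1 by field; rewrite !gt_eqF.
(* Conjugacy turns [2 / q - 1] into the exponent of the theorem. *)
suff -> : (2 - q) * q^-1 = q^-1 - p^-1 by [].
have -> : p^-1 = 1 - q^-1 by rewrite -pq1 addrK.
by field; rewrite gt_eqF.
Qed.
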